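(* For every $\varepsilon>0$ and every integer $g$, there exist a finite graph $G$ of girth at least $g$ and a probability distribution $D$ with finite support over weight functions $w:E(G)\to\mathbb{R}_{>0}$ such that every (randomized) algorithm $a$ for the graphic matroid secretary problem on $G$ satisfies $$\mathbb{E}_{w\sim D}\left[\frac{\mathbb{E}[w(a(G,w))]}{OPT(G,w)}\right]<\frac1e+\varepsilon,$$ where the inner expectation is over the uniformly random arrival order and the algorithm's randomness. Consequently, for every $g$, no algorithm for the graphic matroid secretary problem on graphs of girth at least $g$ achieves a competitive ratio smaller than $e$.
   Context: Graphic matroid secretary problem: edges of a fixed known graph $G$ carry weights; edges arrive one at a time in uniformly random order, revealing their weight; the algorithm must irrevocably accept or reject each edge on arrival, keeping the accepted set acyclic. The algorithm may know $G$ and $D$ in advance and may be randomized. $w(a(G,w))$ denotes the total weight of edges accepted by $a$ and $OPT(G,w)$ the maximum weight of an acyclic edge set. The girth of a graph is the length of its shortest cycle. An algorithm is $\alpha$-competitive on a family of weighted graphs if $\alpha\,\mathbb{E}[ALG]\ge OPT$ for every member. *)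

(* Defs.v *)
From HB Require Import structures.
From mathcomp Require Import all_boot all_order all_algebra fingroup perm.
From mathcomp Require Import boolp reals sequences exp.
Set Implicit Arguments. Unset Strict Implicit. Unset Printing Implicit Defensive.
Import Order.TTheory GRing.Theory Num.Theory.
Local Open Scope ring_scope.

Record graph := Graph {
  vertex : finType;
  edge : finType;
  ends : edge -> vertex * vertex }.

Definition joins (G : graph) (e : edge G) (u v : vertex G) : bool :=
  (ends e == (u, v)) || (ends e == (v, u)).

Definition simple_graph (G : graph) : Prop :=
  (forall e : edge G, (ends e).1 != (ends e).2) /\
  (forall e f : edge G, joins f (ends e).1 (ends e).2 -> e = f).

Definition has_cycle_len (G : graph) (F : {set edge G}) (k : nat) : Prop :=
  (0 < k)%N /\
  exists (es : 'I_k -> edge G) (vs : 'I_k -> vertex G),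
    [/\ injective es, injective vs, (forall i, es i \in F) &
        (forall i, joins (es i) (vs i) (vs (ordS i)))].

Definition acyclic (G : graph) (F : {set edge G}) : Prop :=
  forall k, ~ has_cycle_len F k.

Definition girth_ge (G : graph) (g : nat) : Prop :=
  forall k, has_cycle_len [set: edge G] k -> (g <= k)%N.

Section Secretary.
Variable R : realType.
Variable G : graph.

Definition OPT (w : edge G -> R) : R :=
  \big[Num.max/0]_(F : {set edge G} | `[< acyclic F >]) \sum_(e in F) w e.

(* History observed by an online algorithm: arrived edges, their weights,
   and the algorithm's own accept(true)/reject(false) decisions. *)
Definition history := seq (edge G * R * bool).

Definition accepted (h : history) : {set edge G} :=
  [set e | has (fun t => (t.1.1 == e) && t.2) h].

(* A randomized online algorithm (behavioural form): given the history, the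
   arriving edge and its weight, the probability of accepting it. *)
Definition algorithm := history -> edge G -> R -> R.

Definition valid_algorithm (p : algorithm) : Prop :=
  forall h e x, 0 <= p h e x <= 1 /\
    (p h e x != 0 -> acyclic (e |: accepted h)).

Fixpoint run (p : algorithm) (w : edge G -> R) (o : seq (edge G)) (h : history)
  : R :=
  match o with
  | [::] => 0
  | e :: o' =>
      p h e (w e) * (w e + run p w o' (rcons h (e, w e, true)))
      + (1 - p h e (w e)) * run p w o' (rcons h (e, w e, false))
  end.

Definition expected_alg (p : algorithm) (w : edge G -> R) : R :=
  ((#|edge G|)`!%:R)^-1 *
  \sum_(s : {perm edge G}) run p w [seq s x | x <- enum (edge G)] [::].

Definition positive_weights (w : edge G -> R) : Prop := forall e, 0 < w e.

Definition weight_distribution (D : seq (R * (edge G -> R))) : Prop :=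
  (forall qw, qw \in D -> 0 <= qw.1 /\ positive_weights qw.2) /\
  \sum_(qw <- D) qw.1 = 1.

End Secretary.

(* an algorithm for each graph (algorithms may know G) *)
Definition alg_family (R : realType) := forall G : graph, algorithm R G.

Definition competitive_on (R : realType) (alpha : R) (fam : graph -> Prop)
  (A : alg_family R) : Prop :=
  forall G, fam G -> forall w : edge G -> R, positive_weights w ->
    OPT w <= alpha * expected_alg (A G) w.

(* Main.v *)
Require Import Defs.
From HB Require Import structures.
From mathcomp Require Import all_boot all_order all_algebra fingroup perm.
From mathcomp Require Import boolp reals sequences exp.
From mathcomp Require Import zify ring lra.
Set Implicit Arguments. Unset Strict Implicit. Unset Printing Implicit Defensive.
Import Order.TTheory GRing.Theory Num.Theory.

(* Take a bipartite graph of large girth whose "centers" all have degree [d] and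
   are far more numerous than the other vertices.  A forest can contain more than
   one edge at a center only a negligible number of times, so an algorithm
   essentially faces one single-choice secretary problem per star.  Each star
   independently draws weights [M ^ l] at distinct random levels [l] from a
   scale-free distribution under which the revealed levels carry no more
   information than their relative ranks; this costs a factor [1/e] in every star
   and for every arrival order.  Finally the joint distribution is reweighted by
   [OPT], which turns [E ALG / E OPT] into [E (ALG / OPT)]. *)

(** * Forests and graphs of large girth *)

Local Open Scope nat_scope.

(** The algorithm knows the distribution and sees weights, not just ranks, so the scale itself must
    stay unpredictable. With [k] edges of a star revealed and largest level [m >= d] (counted from
    1), the completions in which [m] stays the maximum have total measure [1 / (m ^_ k)], however
    many edges are still to come. Only finitely many levels [J] can be used; this cut-off leaves a
    quotient of a harmonic sum and its tail from [d] on, which tends to 1 because the series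
    diverges. The constants are chosen in the order [d], [J], [M], [C]: [1 / M] bounds the relative
    value of an edge that is not maximal in its star, and [C] must outweigh [M ^ J], a bound for the
    weight of a surplus edge. *)

Lemma joins_endsP (G : graph) (e : edge G) (u v : vertex G) :
  reflect (ends e = (u, v) \/ ends e = (v, u)) (joins e u v).
Proof. by apply: (iffP orP) => -[] /eqP E; [left|right|left|right] => //; apply/eqP. Qed.

Lemma joins_inj (G : graph) (e : edge G) (u v u' v' : vertex G) :
  joins e u v -> joins e u' v' -> (u = u' /\ v = v') \/ (u = v' /\ v = u').
Proof.
by move=> /joins_endsP J /joins_endsP; case: J => -> [] [-> ->]; [left|right|right|left].
Qed.

(* A repetition [vs i = vs (i + k)] with [k] minimal closes a cycle; the edges
   of the closed segment are distinct because the walk never turns back. *)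
Lemma nonbacktracking_cycle (G : graph) (F : {set edge G})
    (vs : nat -> vertex G) (es : nat -> edge G) n :
  0 < n -> (forall i, es i \in F) ->
  (forall i, joins (es i) (vs i) (vs i.+1)) ->
  (forall i, es i != es i.+1) -> vs 0 = vs n ->
  exists2 k, k <= n & has_cycle_len F k /\
    (k = n -> {in gtn n &, injective es}).
Proof.
move=> n_gt0 esF esJ esNB vs0n.
pose P k := (0 < k) && [exists i : 'I_n.+1, (i + k <= n) && (vs i == vs (i + k))].
have exP : exists k, P k.
  by exists n; rewrite /P n_gt0; apply/existsP; exists ord0; rewrite /= add0n leqnn vs0n eqxx.
case: (ex_minnP exP) => k /andP[k_gt0 /existsP[i0 /andP[i0k /eqP vsk]]] kmin.
have gap a b : a < b -> b <= n -> vs a = vs b -> k <= b - a.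
  move=> ab bn E; apply: kmin; rewrite /P subn_gt0 ab; apply/existsP.
  have an : a < n.+1 by lia.
  by exists (Ordinal an); rewrite /= subnKC ?(ltnW ab) // bn E eqxx.
have vinj a b : a < b -> b < i0 + k -> i0 <= a -> vs a <> vs b.
  by move=> ab bk ia /(gap _ _ ab); lia.
have einj a b : a < b -> b < i0 + k -> i0 <= a -> es a <> es b.
  move=> ab bk ia E.
  (* A repeated edge traversed in the same direction repeats a vertex. In the opposite direction,
     minimality leaves only [b = a.+1], an immediate turn back. *)
  case: (joins_inj (esJ a) (eq_ind_r (fun e => joins e _ _) (esJ b) E)) => -[E1 E2].
    exact: (vinj a b).
  have := gap a b.+1 _ _ E1 => /(_ ltac:(lia) ltac:(lia)) kb.
  have [ab1|ab1] := leqP b a.+1; last first.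
    by have := gap a.+1 b ab1 ltac:(lia) E2; lia.
  have eb : b = a.+1 by lia.
  by move: (esNB a); rewrite -eb E eqxx.
exists k; first by lia.
split; last first.
  move=> kn a b; rewrite !inE => an bn E.
  have i00 : (i0 : nat) = 0 by lia.
  by case: (ltngtP a b) => // ab; [case: (einj a b)|case: (einj b a)] => //; lia.
split=> //; exists (fun i : 'I_k => es (i0 + i)), (fun i : 'I_k => vs (i0 + i)); split => //.
- move=> a b E; apply: val_inj => /=.
  by case: (ltngtP a b) => // ab; [case: (einj (i0+a) (i0+b))|case: (einj (i0+b) (i0+a))] => //;
    have := ltn_ord a; have := ltn_ord b; lia.
- move=> a b E; apply: val_inj => /=.
  by case: (ltngtP a b) => // ab; [case: (vinj (i0+a) (i0+b))|case: (vinj (i0+b) (i0+a))] => //;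
    have := ltn_ord a; have := ltn_ord b; lia.
- move=> a; have := esJ (i0 + a); rewrite -addnS.
  suff -> : vs (i0 + a.+1) = vs (i0 + ordS a) by [].
  rewrite /=; have [ak|ak] := ltnP a.+1 k; first by rewrite modn_small.
  have -> : a.+1 = k by have := ltn_ord a; lia.
  by rewrite modnn addn0 vsk.
Qed.

Definition incident (G : graph) (e : edge G) (v : vertex G) : bool :=
  ((ends e).1 == v) || ((ends e).2 == v).

Lemma has_cycle_lenS (G : graph) (F F' : {set edge G}) k :
  F \subset F' -> has_cycle_len F k -> has_cycle_len F' k.
Proof.
move=> /subsetP sF [k0 [es [vs [? ? eF ?]]]]; split=> //.
by exists es, vs; split=> // i; apply: sF.
Qed.

(** Leave the far end of each edge through a different edge: the walk never turns back, and by
    finiteness a vertex recurs. The vertex in a state is the end from which its edge is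
    traversed. *)
Lemma min_degree2_cycle (G : graph) (F : {set edge G}) (e0 : edge G) :
  e0 \in F ->
  (forall e v, e \in F -> incident e v ->
     exists2 e', e' \in F & incident e' v && (e' != e)) ->
  exists k, has_cycle_len F k.
Proof.
move=> e0F deg.
pose other (e : edge G) v := if (ends e).1 == v then (ends e).2 else (ends e).1.
pose next (s : edge G * vertex G) := let u := other s.1 s.2 in
  (odflt s.1 [pick e' in F | incident e' u && (e' != s.1)], u).
pose st n := iter n next (e0, (ends e0).1).
have stS n : st n.+1 = next (st n) by [].
have other_inc e v : incident e (other e v).
  by rewrite /incident /other; case: ifP; rewrite eqxx ?orbT.
have inv n : ((st n).1 \in F) && incident (st n).1 (st n).2.
  elim: n => [|n /andP[IH1 IH2]]; first by rewrite /= e0F /incident eqxx.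
  rewrite stS /next /=; case: pickP => [e' /andP[-> /andP[-> _]] //|/= none].
  have [e' e'F /andP[e1 e2]] := deg _ _ IH1 (other_inc (st n).1 (st n).2).
  by have := none e'; rewrite e'F e1 e2.
have NB n : (st n).1 != (st n.+1).1.
  have /andP[IH1 IH2] := inv n.
  rewrite stS /next /=; case: pickP => [e' /andP[_ /andP[_]]|/= none].
    by rewrite eq_sym.
  have [e' e'F /andP[e1 e2]] := deg _ _ IH1 (other_inc (st n).1 (st n).2).
  by have := none e'; rewrite e'F e1 e2.
have J n : joins (st n).1 (st n).2 (st n.+1).2.
  have /andP[_] := inv n; rewrite stS /next /=.
  rewrite /incident /joins /other; case: (ends _) => a b /=.
  by case: (altP (a =P _)) => /= [->|ab /eqP ->]; rewrite eqxx ?orbT.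
have [i [j [ij Eij]]] : exists i j, i < j /\ (st i).2 = (st j).2.
  have : ~~ injectiveb (fun i : 'I_#|vertex G|.+1 => (st i).2).
    by apply/negP => /injectiveP /leq_card; rewrite card_ord ltnn.
  move=> /injectivePn[x [y xy E]].
  case: (ltngtP x y) => [xy'|xy'|/val_inj xy']; [by exists x, y|by exists y, x|].
  by rewrite xy' eqxx in xy.
have [|||||k _ [ck _]] := @nonbacktracking_cycle G F (fun n => (st (i + n)).2)
  (fun n => (st (i + n)).1) (j - i).
- by rewrite subn_gt0.
- by move=> n; case/andP: (inv (i + n)).
- by move=> n; rewrite addnS.
- by move=> n; rewrite addnS.
- by rewrite addn0 subnKC // ltnW.
by exists k.
Qed.

(** Unless [F] is empty, [min_degree2_cycle] yields an edge that is alone at one of its endpoints.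
    Deleting it uncovers that endpoint, and induction applies. *)
Lemma acyclic_card (G : graph) (F : {set edge G}) :
  acyclic F -> #|F| <= #|[set v | [exists e in F, incident e v]]|.
Proof.
have [n] := ubnP #|F|; elim: n F => // n IH F Fn acF.
have [->|[e0 e0F]] := set_0Vmem F; first by rewrite cards0.
have /existsP[e /existsP[v /and3P[eF ev /forallP leaf]]] : [exists e, exists v,
    [&& e \in F, incident e v & [forall e', (e' \in F) && incident e' v ==> (e' == e)]]].
  apply: contraT => H; have [|k /(acF k) //] := min_degree2_cycle e0F.
  move=> e v eF ev; have := H; rewrite negb_exists => /forallP /(_ e).
  rewrite negb_exists => /forallP /(_ v); rewrite eF ev /= negb_forall => /existsP[e'].
  by rewrite negb_imply => /andP[/andP[e'F e'v] ne]; exists e'; rewrite ?e'v.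
have acF' : acyclic (F :\ e).
  by move=> k ck; apply: (acF k); apply: has_cycle_lenS ck; apply: subD1set.
have := cardsD1 e F; rewrite eF add1n => cF.
rewrite cF; apply: leq_trans (_ : #|[set v0 | [exists e1 in F, incident e1 v0]] :\ v|.+1 <= _).
  rewrite ltnS; apply: leq_trans (IH _ _ acF') _; first by lia.
  apply: subset_leq_card; apply/subsetP => x; rewrite !inE => /existsP[e1 /andP[]].
  rewrite !inE => /andP[e1e e1F] e1x; apply/andP; split;
    last by apply/existsP; exists e1; rewrite e1F.
  apply: contraNneq e1e => xv; have := leaf e1.
  by rewrite e1F -xv e1x.
rewrite [X in _ <= X](cardsD1 v) inE.
suff -> : [exists e1 in F, incident e1 v] by [].
by apply/existsP; exists e; rewrite eF.
Qed.

(** To be read as a budget: the surplus of a forest over one edge per touched vertex of [A] does not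
    grow with [A]. *)
Lemma bipartite_acyclic_card (G : graph) (A : {set vertex G}) (F : {set edge G}) :
  (forall e : edge G, (ends e).1 \in A) -> (forall e : edge G, (ends e).2 \notin A) ->
  acyclic F -> #|F| <= #|[set (ends e).1 | e in F]| + #|~: A|.
Proof.
move=> e1A e2A /acyclic_card /leq_trans; apply.
apply: leq_trans (subset_leq_card _) (leq_card_setU _ _).
apply/subsetP => v; rewrite !inE => /existsP[e /andP[eF /orP[]/eqP <-]].
  by rewrite (imset_f (fun e : edge G => (ends e).1) eF).
by rewrite e2A orbT.
Qed.

(** A cycle meets [A], and its two edges there share their first endpoint, hence coincide, which
    forces a loop. This makes one edge per star a feasible set for [OPT]. *)
Lemma star_choice_acyclic (G : graph) (A : {set vertex G}) (F : {set edge G}) :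
  (forall e : edge G, (ends e).1 \in A) -> (forall e : edge G, (ends e).2 \notin A) ->
  {in F &, injective (fun e => (ends e).1)} -> acyclic F.
Proof.
move=> e1A e2A inj k [k0 [es [vs [esI vsI esF esJ]]]].
have noloop (e : edge G) v : joins e v v -> False.
  by move=> /joins_endsP; case=> E; have := e1A e; have := e2A e; rewrite E /= => /negP.
have key i : vs i \in A -> False.
  move=> iA; have J1 := esJ i; have J2 := esJ (ord_pred i); rewrite ord_predK in J2.
  have E1 : (ends (es i)).1 = vs i.
    by move: J1 => /joins_endsP[] E; have := e2A (es i); rewrite E //= iA.
  have E2 : (ends (es (ord_pred i))).1 = vs i.
    by move: J2 => /joins_endsP[] E; have := e2A (es (ord_pred i)); rewrite E //= iA.
  have /esI Ei : es i = es (ord_pred i) by apply: inj; rewrite ?esF // E1 E2.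
  by move: J1; rewrite {3}Ei ord_predK; apply: noloop.
have := e1A (es (Ordinal k0)).
by move: (esJ (Ordinal k0)) => /joins_endsP[] -> /=; apply: key.
Qed.

(* Homology cover over Z/2: sheets are indexed by edge sets, and traversing [e]
   in either direction toggles [e]. *)
Definition cover_graph (G : graph) : graph :=
  @Graph (vertex G * {set edge G})%type (edge G * {set edge G})%type
    (fun ex => let: (e, x) := ex in
      (((ends e).1, x), ((ends e).2, if e \in x then x :\ e else e |: x))).

Lemma toggle_inj (T : finType) (e : T) (x y : {set T}) :
  (if e \in x then x :\ e else e |: x) = (if e \in y then y :\ e else e |: y) -> x = y.
Proof.
move=> E; apply/setP => z; move/setP/(_ z): E.
by case: (boolP (e \in x)); case: (boolP (e \in y)) => ey ex; rewrite !inE;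
  have [->|] := eqVneq z e; rewrite ?(negbTE ex) ?(negbTE ey) ?ex ?ey.
Qed.

Lemma mem_toggle (T : finType) (e z : T) (x : {set T}) :
  (z \in (if e \in x then x :\ e else e |: x)) = (z \in x) (+) (z == e).
Proof.
have [->|ne] := eqVneq z e; case: ifP => ex; rewrite !inE ?eqxx ?ex //= ?(negbTE ne) ?ne ?addbF //.
Qed.

Lemma cover_joins (G : graph) (e : edge (cover_graph G)) u v :
  joins e u v -> joins e.1 u.1 v.1 /\
    forall z, (z \in v.2) = (z \in u.2) (+) (z == e.1).
Proof.
case: e u v => e x [u y] [v t] /joins_endsP /= [] [<- <- <- <-]; split.
- by rewrite /joins -surjective_pairing eqxx.
- by move=> z; rewrite mem_toggle.
- by rewrite /joins -surjective_pairing eqxx orbT.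
- by move=> z; rewrite mem_toggle -addbA addbb addbF.
Qed.

(* A cycle of the cover projects to a non-backtracking closed walk using each
   edge of [G] an even number of times, so it properly contains a cycle of [G]. *)
Lemma cover_girth (G : graph) (g : nat) :
  (forall e : edge G, (ends e).1 != (ends e).2) ->
  girth_ge G g -> girth_ge (cover_graph G) g.+1.
Proof.
move=> noloop gG k [k0 [es [vs [esI vsI _ esJ]]]].
pose o i : 'I_k := Ordinal (ltn_pmod i k0).
have oS i : o i.+1 = ordS (o i) by apply: val_inj; rewrite /= -addn1 -[in RHS]addn1 modnDml.
have Jb i : joins (es (o i)).1 (vs (o i)).1 (vs (o i.+1)).1.
  by rewrite oS; case: (cover_joins (esJ (o i))).
have Jt i z : (z \in (vs (o i.+1)).2) = (z \in (vs (o i)).2) (+) (z == (es (o i)).1).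
  by rewrite oS; case: (cover_joins (esJ (o i))).
have vsk : vs (o 0) = vs (o k) by congr vs; apply: val_inj; rewrite /= mod0n modnn.
have k1 : 1 < k.
  rewrite ltn_neqAle k0 andbT; apply/eqP => k1.
  have := Jb 0; have -> : o 1 = o 0 by apply: val_inj; rewrite /= -k1 !modn1.
  by move=> /joins_endsP[] E; have := noloop (es (o 0)).1; rewrite E eqxx.
(* Each vertex of the cover meets at most one lift of a given non-loop edge, so consecutive cycle
   edges with the same projection would be equal; [1 < k] excludes this. *)
have NB i : (es (o i)).1 != (es (o i.+1)).1.
  apply/eqP => E.
  have : es (o i) = es (o i.+1).
    have := esJ (o i); have := esJ (o i.+1); rewrite -!oS.
    have := Jb i; rewrite {1}E.
    case: (es (o i)) E => a x /= ->; case: (es (o i.+1)) => b y /=.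
    move=> _ /joins_endsP /= J2 /joins_endsP /= J1.
    have nl := noloop b; congr pair.
    case: J1 => -[A1 A2]; case: J2 => -[B1 B2].
    - by move: B1; rewrite -A2 => -[E1 _]; rewrite E1 eqxx in nl.
    - by move: B2; rewrite -A2 => -[/toggle_inj].
    - by move: B1; rewrite -A1 => -[].
    - by move: B2; rewrite -A1 => -[E1 _]; rewrite E1 eqxx in nl.
  move=> /esI /(congr1 val) /=.
  rewrite -addn1 -{1}[i]addn0 => /eqP; rewrite eqn_modDl mod0n modn_small //.
have [|||||c ck [hc inj]] := @nonbacktracking_cycle G [set: edge G]
  (fun i => (vs (o i)).1) (fun i => (es (o i)).1) k => //.
- by rewrite vsk.
have gc := gG c hc.
rewrite (leq_ltn_trans gc) // ltn_neqAle ck andbT.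
apply/eqP => ckE; have {}inj := inj ckE.
(* If the projected edges were all distinct, the first one would be toggled exactly once and the
   walk could not return to its initial sheet. *)
have par n : n < k -> ((es (o 0)).1 \in (vs (o n.+1)).2) = ~~ ((es (o 0)).1 \in (vs (o 0)).2).
  elim: n => [|n IH] nk; rewrite Jt; first by rewrite eqxx addbT.
  rewrite IH; last exact: ltnW.
  suff /negbTE -> : (es (o 0)).1 != (es (o n.+1)).1 by rewrite addbF.
  by apply/eqP => /inj; rewrite !inE => /(_ k0 nk).
have := par k.-1 ltac:(lia); rewrite prednK // -vsk.
by case: (_ \in _).
Qed.

(** * Unbalanced bipartite graphs of large girth *)

Record star_graph (G : graph) (A : {set vertex G}) (d C g : nat) : Prop := StarGraph {
  star_simple : simple_graph G;
  star_girth : girth_ge G g;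
  star_ends1 : forall e : edge G, (ends e).1 \in A;
  star_ends2 : forall e : edge G, (ends e).2 \notin A;
  star_degree : forall v, v \in A -> #|[set e : edge G | (ends e).1 == v]| = d;
  star_many : #|A| = C * #|~: A|;
  star_nonempty : 0 < #|~: A| }.

(** The cover multiplies both sides of the bipartition by the number of sheets and keeps the
    degrees, so [d] and [C] survive while the girth bound grows by one. *)
Lemma star_cover (G : graph) (A : {set vertex G}) d C g :
  star_graph A d C g ->
  @star_graph (cover_graph G) [set x | x.1 \in A] d C g.+1.
Proof.
case=> -[noloop simp] gG e1 e2 deg many ne.
have noloop' (e : edge (cover_graph G)) : (ends e).1 != (ends e).2.
  case: e => e x /=; apply/eqP => -[E _]; by have := noloop e; rewrite E eqxx.
have cardA : #|[set x : vertex (cover_graph G) | x.1 \in A]| = #|A| * #|{set edge G}|.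
  rewrite -[#|{set edge G}|]cardsT -cardsX; congr #|pred_of_set _|.
  by apply/setP => -[v x]; rewrite !inE andbT.
have cardA' : #|~: [set x : vertex (cover_graph G) | x.1 \in A]| = #|~: A| * #|{set edge G}|.
  rewrite -[#|{set edge G}|]cardsT -cardsX; congr #|pred_of_set _|.
  by apply/setP => -[v x]; rewrite !inE andbT.
split.
- split=> // -[e x] [f y] /joins_endsP /= [] [E1 E2 E3 E4].
    by congr pair => //; apply: simp; rewrite /joins -E1 -E3 -surjective_pairing eqxx.
  by have := e1 f; have := e2 e; rewrite E1 => /negbTE ->.
- exact: cover_girth.
- by case=> e x; rewrite inE /= e1.
- by case=> e x; rewrite inE /= e2.
- case=> v x; rewrite inE /= => vA; rewrite -(deg v vA).
  rewrite -[RHS]muln1 -(cards1 x) -cardsX; congr #|pred_of_set _|.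
  by apply/setP => -[e y]; rewrite !inE /= xpair_eqE.
- by rewrite cardA cardA' many mulnA.
- by rewrite cardA' muln_gt0 ne; apply/card_gt0P; exists set0.
Qed.

(** Iterated covers of the complete bipartite graph with sides [C * d] and [d], for which the bound
    [g = 0] is vacuous. *)
Lemma star_graph_exists (d C g : nat) : 0 < d ->
  exists (G : graph) (A : {set vertex G}), star_graph A d C g.
Proof.
move=> d0; elim: g => [|g [G [A H]]]; last first.
  by exists (cover_graph G), [set x | x.1 \in A]; apply: star_cover.
pose G := @Graph ('I_(C * d) + 'I_d)%type ('I_(C * d) * 'I_d)%type
  (fun e => (inl e.1, inr e.2)).
pose A : {set vertex G} := [set inl i | i in [set: 'I_(C * d)]].
have inA i : (inl i : vertex G) \in A by apply: (imset_f (fun i => inl i)); rewrite inE.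
have inB i : (inr i : vertex G) \notin A by apply/imsetP => -[].
have cA : #|A| = C * d by rewrite card_imset ?cardsT ?card_ord // => x y [].
have cB : #|~: A| = d.
  have -> : ~: A = [set inr i | i in [set: 'I_d]].
    apply/setP => -[i|i]; rewrite inE ?inA ?inB.
      by apply/esym/imsetP => -[].
    by apply/esym/(imset_f (fun i => inr i)); rewrite inE.
  by rewrite card_imset ?cardsT ?card_ord // => x y [].
exists G, A; split=> //.
- split=> // -[i j] [i' j'] /joins_endsP /= [] // -[-> ->] //.
- by move=> e; apply: inA.
- by move=> e; apply: inB.
- move=> v /imsetP[i _ ->].
  have -> : [set e : edge G | (ends e).1 == inl i] = setX [set i] [set: 'I_d].
    by apply/setP => -[a b]; rewrite !inE /= andbT.
  by rewrite cardsX cards1 cardsT card_ord mul1n.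
- by rewrite cA cB.
- by rewrite cB.
Qed.

(** * Iterated sums and online rewards *)

Local Open Scope ring_scope.

Section IteratedSum.
Variables (R : numDomainType) (E L : finType).
Implicit Types (f : {ffun E -> L}) (t : seq E) (F : {ffun E -> L} -> R).

Definition upd f e l : {ffun E -> L} := [ffun x => if x == e then l else f x].

(** The nesting can follow the arrival order, so that backward induction peels off the next edge.
    Coordinates outside [t] keep their values in [f]: this is an unnormalised conditional
    expectation given the revealed levels. *)
Fixpoint isum t F f : R :=
  if t is e :: t' then \sum_(l : L) isum t' F (upd f e l) else F f.

Lemma isum_cat s t F f : isum (s ++ t) F f = isum s (isum t F) f.
Proof. by elim: s f => //= e s IH f; apply: eq_bigr => l _; rewrite IH. Qed.

Lemma agree_upd e t f l (g : {ffun E -> L}) : e \notin t ->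
  {in predC (mem t), g =1 upd f e l} ->
  {in predC (mem (e :: t)), g =1 f} /\ g e = l.
Proof.
move=> et H; split; last by rewrite H ?inE // ffunE eqxx.
move=> x; rewrite !inE negb_or => /andP[xe xt].
by rewrite H ?inE // ffunE (negbTE xe).
Qed.

Lemma isum_le t F F' f : uniq t ->
  (forall g : {ffun E -> L}, {in predC (mem t), g =1 f} -> F g <= F' g) ->
  isum t F f <= isum t F' f.
Proof.
elim: t f => /= [|e t IH] f; first by move=> _; apply.
move=> /andP[et ut] H; apply: ler_sum => l _; apply: IH => // g /(agree_upd et)[+ _].
exact: H.
Qed.

Lemma eq_isum t F F' f : uniq t ->
  (forall g : {ffun E -> L}, {in predC (mem t), g =1 f} -> F g = F' g) ->
  isum t F f = isum t F' f.
Proof.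
by move=> ut H; apply/le_anti/andP; split; apply: isum_le => // g /H ->.
Qed.

Lemma isumD t F F' f : isum t (fun g => F g + F' g) f = isum t F f + isum t F' f.
Proof.
by elim: t f => //= e t IH f; rewrite -big_split; apply: eq_bigr => l _; apply: IH.
Qed.

Lemma isumZ t c F f : isum t (fun g => c * F g) f = c * isum t F f.
Proof.
by elim: t f => //= e t IH f; rewrite mulr_sumr; apply: eq_bigr => l _; apply: IH.
Qed.

Lemma isum_sum (I : finType) (P : pred I) t (F : I -> {ffun E -> L} -> R) f :
  isum t (fun g => \sum_(i | P i) F i g) f = \sum_(i | P i) isum t (F i) f.
Proof.
elim: t f => //= e t IH f; rewrite exchange_big /=.
by apply: eq_bigr => l _; rewrite IH.
Qed.

Lemma isum0 t f : isum t (fun=> 0) f = 0.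
Proof. by elim: t f => //= e t IH f; rewrite big1. Qed.

(** Without repetitions no assignment is overwritten, so the nested sums flatten and their order
    becomes irrelevant; this lets one star be moved innermost. *)
Lemma isum_agree t F f : uniq t ->
  isum t F f = \sum_(g : {ffun E -> L} | [forall x, (x \notin t) ==> (g x == f x)]) F g.
Proof.
elim: t f => /= [|e t IH] f.
  move=> _; rewrite (big_pred1 f) // => g; apply/forallP/eqP => [H|-> //].
  by apply/ffunP => x; apply/eqP/(H x).
move=> /andP[et ut]; rewrite [RHS](partition_big (fun g : {ffun E -> L} => g e) xpredT) //=.
apply: eq_bigr => l _; rewrite IH //; apply: eq_bigl => g.
apply/forallP/andP => [H|[/forallP H /eqP gel] x].
  split; last by have := H e; rewrite et ffunE eqxx.
  apply/forallP => x; rewrite inE negb_or; apply/implyP => /andP[xe xt].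
  by have := H x; rewrite xt ffunE (negbTE xe).
apply/implyP => xt; rewrite ffunE; case: (x =P e) => [->|/eqP xe]; first by rewrite gel.
by have := H x; rewrite inE negb_or xe xt.
Qed.

Lemma isum_all t F f : uniq t -> (forall x, x \in t) ->
  isum t F f = \sum_(g : {ffun E -> L}) F g.
Proof.
move=> ut allt; rewrite isum_agree //; apply: eq_bigl => g.
by apply/forallP => x; rewrite allt.
Qed.

Lemma isum_perm t t' F f : uniq t -> perm_eq t t' -> isum t F f = isum t' F f.
Proof.
move=> ut tt'; rewrite !isum_agree -?(perm_uniq tt') //.
by apply: eq_bigl => g; apply: eq_forallb => x; rewrite (perm_mem tt').
Qed.

End IteratedSum.

(** * Splitting the reward of an online algorithm *)

Section Gain.
Variables (R : realType) (G : graph).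
Implicit Types (rew : history R G -> edge G -> R) (p : algorithm R G)
  (w : edge G -> R) (o : seq (edge G)) (h : history R G).

(** [run] with the payoff separated from the weights that drive the decisions: the algorithm still
    sees [w] but is credited with [rew], which may depend on the history. *)
Fixpoint gain rew p w o h : R :=
  match o with
  | [::] => 0
  | e :: o' =>
      p h e (w e) * (rew h e + gain rew p w o' (rcons h (e, w e, true)))
      + (1 - p h e (w e)) * gain rew p w o' (rcons h (e, w e, false))
  end.

Lemma run_gain p w o h : run p w o h = gain (fun=> w) p w o h.
Proof. by elim: o h => //= e o IH h; rewrite !IH. Qed.

Lemma gainD rew rew' p w o h :
  gain (fun h e => rew h e + rew' h e) p w o h = gain rew p w o h + gain rew' p w o h.
Proof. by elim: o h => /= [|e o IH] h; [rewrite addr0|rewrite !IH; ring]. Qed.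

Lemma gainZ c rew p w o h :
  gain (fun h e => c * rew h e) p w o h = c * gain rew p w o h.
Proof. by elim: o h => /= [|e o IH] h; [rewrite mulr0|rewrite !IH; ring]. Qed.

Lemma gain0 p w o h : gain (fun _ _ => 0) p w o h = 0.
Proof. by elim: o h => //= e o IH h; rewrite !IH; ring. Qed.

Lemma gain_sum (I : Type) (r : seq I) (P : pred I) (rew : I -> history R G -> edge G -> R) p w o h :
  gain (fun h e => \sum_(i <- r | P i) rew i h e) p w o h
  = \sum_(i <- r | P i) gain (rew i) p w o h.
Proof.
elim: r => [|i r IH].
  rewrite big_nil -[RHS](gain0 p w o h); congr gain.
  by apply/funext => h'; apply/funext => e; rewrite big_nil.
rewrite big_cons -IH; case Pi: (P i); last first.
  by congr gain; apply/funext => h'; apply/funext => e; rewrite big_cons Pi.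
rewrite -gainD; congr gain.
by apply/funext => h'; apply/funext => e; rewrite big_cons Pi.
Qed.

Lemma gain_le rew rew' p w o h : valid_algorithm p ->
  (forall h e, rew h e <= rew' h e) -> gain rew p w o h <= gain rew' p w o h.
Proof.
move=> vp le; elim: o h => //= e o IH h.
have [/andP[p0 p1] _] := vp h e (w e).
by apply: lerD; apply: ler_wpM2l; rewrite ?subr_ge0 // lerD.
Qed.

Definition taken (v : vertex G) h := [exists e in accepted h, (ends e).1 == v].

Lemma accepted_rcons h e x b :
  accepted (rcons h (e, x, b)) = if b then e |: accepted h else accepted h.
Proof.
apply/setP => z; rewrite inE has_rcons /=; case: b; rewrite !inE ?andbF //=.
by rewrite andbT eq_sym.
Qed.

Lemma taken_rcons v h e x b :
  taken v (rcons h (e, x, b)) = b && ((ends e).1 == v) || taken v h.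
Proof.
rewrite /taken accepted_rcons; case: b => //=.
apply/existsP/orP => [[e' /andP[]]|[ev|/existsP[e' /andP[e'h e'v]]]].
- rewrite in_setU1 => /orP[/eqP -> ->|e'h e'v]; first by left.
  by right; apply/existsP; exists e'; rewrite e'h.
- by exists e; rewrite setU11.
- by exists e'; rewrite in_setU1 e'h orbT.
Qed.

Definition first_reward v (c : edge G -> R) h e : R :=
  if ((ends e).1 == v) && ~~ taken v h then c e else 0.

Definition extra_reward (c : edge G -> R) h e : R :=
  if taken (ends e).1 h then c e else 0.

(** An accepted edge is either the first at its centre or a surplus edge. The first kind gives one
    single-choice problem per star; the second is controlled by the forest budget. *)
Lemma run_split p w o h :
  run p w o h = \sum_v gain (first_reward v w) p w o h + gain (extra_reward w) p w o h.
Proof.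
rewrite run_gain -gain_sum -gainD; congr gain; apply/funext => h'; apply/funext => e.
rewrite (bigD1 (ends e).1) //= big1 ?addr0.
  by rewrite /first_reward /extra_reward eqxx; case: taken; rewrite ?addr0 ?add0r.
by move=> v ve; rewrite /first_reward eq_sym (negbTE ve).
Qed.

Lemma gain_first_taken v c p w o h :
  taken v h -> gain (first_reward v c) p w o h = 0.
Proof.
elim: o h => //= e o IH h th; rewrite !IH ?taken_rcons ?th ?orbT //.
by rewrite /first_reward th andbF; ring.
Qed.

Lemma gain_first_notin v c p w o h :
  {in o, forall e, (ends e).1 != v} -> gain (first_reward v c) p w o h = 0.
Proof.
elim: o h => //= e o IH h no; rewrite !IH; first last.
- by move=> x xo; apply: no; rewrite inE xo orbT.
- by move=> x xo; apply: no; rewrite inE xo orbT.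
by rewrite /first_reward (negbTE (no e _)) ?inE ?eqxx //=; ring.
Qed.

Lemma gain_first_le1 v p w o h : valid_algorithm p ->
  gain (first_reward v (fun=> 1)) p w o h <= 1.
Proof.
move=> vp; elim: o h => //= e o IH h.
have [/andP[p0 p1] _] := vp h e (w e).
have IHf := IH (rcons h (e, w e, false)); have IHt := IH (rcons h (e, w e, true)).
rewrite /first_reward; case: ifP => [/andP[ev nt]|_].
  by rewrite gain_first_taken ?taken_rcons ?ev //; nra.
by nra.
Qed.

(* Each extra edge lowers the slack in [bipartite_acyclic_card] by one. *)
Lemma gain_extra_le (A : {set vertex G}) (W : R) p w o h :
  (forall e : edge G, (ends e).1 \in A) -> (forall e : edge G, (ends e).2 \notin A) ->
  valid_algorithm p -> 0 <= W -> (forall e, w e <= W) ->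
  uniq o -> {in o, forall e, e \notin accepted h} -> acyclic (accepted h) ->
  gain (extra_reward w) p w o h
    <= W * (#|~: A|%:R + #|[set (ends e).1 | e in accepted h]|%:R - #|accepted h|%:R).
Proof.
move=> e1A e2A vp W0 wW; elim: o h => /= [|e o IH] h.
  move=> _ _ ac; apply: mulr_ge0 => //; rewrite subr_ge0 -natrD ler_nat addnC.
  exact: bipartite_acyclic_card.
move=> /andP[eo uo] oh ac; have [/andP[p0 p1] pac] := vp h e (w e).
have eh : e \notin accepted h by apply: oh; rewrite inE eqxx.
have IHf : gain (extra_reward w) p w o (rcons h (e, w e, false))
    <= W * (#|~: A|%:R + #|[set (ends e).1 | e in accepted h]|%:R - #|accepted h|%:R).
  have := IH (rcons h (e, w e, false)); rewrite accepted_rcons; apply => //.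
  by move=> x xo; apply: oh; rewrite inE xo orbT.
(* Validity guarantees that accepting [e] keeps the set acyclic only when the acceptance probability
   is nonzero. *)
have [->|pn0] := eqVneq (p h e (w e)) 0; first by rewrite mul0r add0r subr0 mul1r.
have IHt : extra_reward w h e + gain (extra_reward w) p w o (rcons h (e, w e, true))
    <= W * (#|~: A|%:R + #|[set (ends e).1 | e in accepted h]|%:R - #|accepted h|%:R).
  have oh' : {in o, forall x, x \notin e |: accepted h}.
    move=> x xo; rewrite in_setU1 negb_or oh ?inE ?xo ?orbT ?andbT //.
    by apply: contraNneq eo => <-.
  have := IH (rcons h (e, w e, true)); rewrite accepted_rcons => /(_ uo oh' (pac pn0)).
  rewrite cardsU1 eh imsetU1 cardsU1.
  have -> : ((ends e).1 \in [set (ends e0).1 | e0 in accepted h]) = taken (ends e).1 h.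
    apply/imsetP/existsP => [[e' e'h ->]|[e' /andP[e'h /eqP <-]]]; last by exists e'.
    by exists e'; rewrite e'h /=.
  rewrite /extra_reward !natrD; case: taken => /= H.
    by have := wW e; nra.
  by nra.
by nra.
Qed.

End Gain.

(** * One star *)

Section Star.
Variables (R : realType) (E : finType) (J : nat) (S : {set E}).
Implicit Types (f g : {ffun E -> 'I_J}) (t : seq E) (A : {set E}).

(** Shifted by one, so that 0 stands for no revealed level and the value counts the levels up to the
    maximum. *)
Definition top A f : nat := \max_(x in A) (f x).+1.

(* Up to normalisation: draw the top level [m >= #|S|] with probability
   proportional to [1/m], then a uniform injection of [S] into the levels up to
   [m] that attains [m].  The revealed levels then say nothing beyond their
   relative ranks about whether the current top is the final one. *)
Definition star_measure f : R :=
  if dinjectiveb f S then ((top S f) ^_ #|S|)%:R^-1 else 0.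

Definition is_top f e : R := ((f e).+1 == top S f)%:R.

(** [t] lists edges still to arrive, so these are the edges of the star already revealed. *)
Definition seen t : {set E} := S :\: [set x in t].

Lemma star_measure_ge0 f : 0 <= star_measure f.
Proof. by rewrite /star_measure; case: ifP => // _; rewrite invr_ge0 ler0n. Qed.

Lemma mem_seen t x : (x \in seen t) = (x \in S) && (x \notin t).
Proof. by rewrite !inE andbC. Qed.

Lemma seen_cons e t : e \in S -> e \notin t -> seen t = e |: seen (e :: t).
Proof.
move=> eS et; apply/setP => x; rewrite in_setU1 !mem_seen inE.
by have [->|//] := eqVneq x e; rewrite eS et.
Qed.

Lemma card_seen t : uniq t -> {subset t <= S} -> (#|seen t| + size t = #|S|)%N.
Proof.
move=> ut tS; rewrite -(cardsID [set x in t] S) addnC; congr (_ + _)%N.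
rewrite -(card_uniqP ut); apply: eq_card => x; rewrite !inE.
by case: (boolP (x \in t)) => [/tS ->|]; rewrite ?andbF.
Qed.

Lemma leq_top A f x : x \in A -> (f x < top A f)%N.
Proof. by move=> xA; apply: (@leq_bigmax_cond _ (fun x => x \in A) (fun x => (f x).+1)). Qed.

Lemma eq_top A f g : {in A, f =1 g} -> top A f = top A g.
Proof. by move=> fg; apply: eq_bigr => x xA; rewrite fg. Qed.

Lemma top_le A f : (top A f <= J)%N.
Proof. by apply/bigmax_leqP => x _. Qed.

Lemma top_upd A f e l : e \notin A -> top (e |: A) (upd f e l) = maxn l.+1 (top A f).
Proof.
move=> eA; rewrite /top big_setU1 //= ffunE eqxx; congr maxn.
by apply: eq_bigr => x xA; rewrite ffunE; case: eqP => // xe; rewrite -xe xA in eA.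
Qed.

Lemma upd_inj A f e l : e \notin A -> {in A &, injective f} -> l \notin f @: A ->
  {in e |: A &, injective (upd f e l)}.
Proof.
move=> eA fI lA x y; rewrite !in_setU1 !ffunE.
have nfl z : z \in A -> f z != l by move=> zA; apply: contraNneq lA => <-; apply: imset_f.
case: (x =P e) => [->|_] /= xA; case: (y =P e) => [-> //|_] /= yA E1.
- by have := nfl y yA; rewrite E1 eqxx.
- by have := nfl x xA; rewrite E1 eqxx.
- exact: fI.
Qed.

Lemma isum_dup t (X : {ffun E -> 'I_J} -> R) f x y : uniq t -> x != y ->
  x \in seen t -> y \in seen t -> f x = f y ->
  isum t (fun g => star_measure g * X g) f = 0.
Proof.
move=> ut xy; rewrite !mem_seen => /andP[xS xt] /andP[yS yt] fxy.
rewrite -(isum0 _ t f); apply: eq_isum => // g gf.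
rewrite /star_measure; case: dinjectiveP => [gI|_]; last by rewrite mul0r.
by move: xy; rewrite (gI x y) ?eqxx // !gf.
Qed.

Lemma isum_upd_dup e t (X : {ffun E -> 'I_J} -> R) f l : uniq (e :: t) -> e \in S ->
  l \in f @: seen (e :: t) ->
  isum t (fun g => star_measure g * X g) (upd f e l) = 0.
Proof.
move=> /= /andP[et ut] eS /imsetP[x xs ->].
have xe : x != e by move: xs; rewrite mem_seen inE negb_or => /and3P[].
apply: (isum_dup _ ut xe); first by rewrite (seen_cons eS et) in_setU1 xs orbT.
  by rewrite mem_seen eS.
by rewrite !ffunE eqxx (negbTE xe).
Qed.

Lemma isum_not_top t f e x : uniq t -> e \notin t -> x \in seen t ->
  (f e < f x)%N -> isum t (fun g => star_measure g * is_top g e) f = 0.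
Proof.
move=> ut et; rewrite mem_seen => /andP[xS xt] fex.
rewrite -(isum0 _ t f); apply: eq_isum => // g gf.
rewrite /is_top (_ : _ == _ = false) ?mulr0 //; apply/eqP => gt.
by have := leq_top g xS; rewrite -gt !gf ?inE // ltnS leqNgt fex.
Qed.

Lemma card_lt_ord m : (m <= J)%N -> #|[set l : 'I_J | (l < m)%N]| = m.
Proof.
move=> mJ; have wI : injective (widen_ord mJ) by move=> i j [/val_inj].
rewrite -[RHS]card_ord -cardsT -(card_imset _ wI).
apply: eq_card => l; rewrite inE; apply/idP/imsetP => [lm|[i _ ->] //=].
by exists (Ordinal lm) => //; apply: val_inj.
Qed.

Definition fresh_below A f m : {set 'I_J} := [set l : 'I_J | (l < m)%N] :\: f @: A.

Lemma card_fresh_below A f : {in A &, injective f} ->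
  (#|fresh_below A f (top A f)| = top A f - #|A|)%N.
Proof.
move=> fI; rewrite cardsD card_lt_ord ?top_le //; congr (_ - _)%N.
rewrite -(card_in_imset fI); congr #|pred_of_set _|; apply/setIidPr.
by apply/subsetP => _ /imsetP[x xA ->]; rewrite inE leq_top.
Qed.

Lemma card_le_top A f : {in A &, injective f} -> (#|A| <= top A f)%N.
Proof.
move=> fI; rewrite -(card_in_imset fI) -[leqRHS](card_lt_ord (top_le A f)).
apply: subset_leq_card; apply/subsetP => _ /imsetP[x xA ->].
by rewrite inE leq_top.
Qed.

(** With [k] levels revealed and maximum [m], the others must take distinct fresh levels below [m];
    if [#|S| <= m] there are [m ^_ #|S|] over [m ^_ k] ways. The measure cancels the numerator, and
    the number of edges still to come disappears from the value. *)
Lemma isum_top t e0 f : uniq t -> {subset t <= S} -> e0 \in seen t ->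
  {in seen t &, injective f} -> (f e0).+1 = top (seen t) f ->
  isum t (fun g => star_measure g * is_top g e0) f
  = (#|S| <= (f e0).+1)%:R / ((f e0).+1 ^_ #|seen t|)%:R.
Proof.
elim: t f => [|e t IH] f ut tS e0s fI e0top.
  have sS : seen [::] = S by apply/setP => x; rewrite mem_seen andbT.
  move: fI e0top; rewrite sS => fI e0top /=.
  rewrite /star_measure /is_top e0top eqxx mulr1.
  rewrite (_ : dinjectiveb f S) //; last exact/dinjectiveP.
  have [|lt] := leqP; first by rewrite mul1r.
  by rewrite ffact_small // invr0 mulr0.
have /andP[et ut'] := ut; have eS : e \in S by apply: tS; rewrite inE eqxx.
have tS' : {subset t <= S} by move=> x xt; apply: tS; rewrite inE xt orbT.
have [m mE] : exists m, m = (f e0).+1 by exists (f e0).+1.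
have es : e \notin seen (e :: t) by rewrite mem_seen inE eqxx andbF.
have e0e : e0 != e by apply/eqP => E0; move: es; rewrite -{1}E0 e0s.
have e0s' : e0 \in seen t by rewrite (seen_cons eS et) in_setU1 e0s orbT.
have e0t : e0 \notin t by move: e0s'; rewrite mem_seen => /andP[].
have ks : #|seen t| = #|seen (e :: t)|.+1 by rewrite (seen_cons eS et) cardsU1 es.
have kd : (#|seen (e :: t)| < #|S|)%N by rewrite -(card_seen ut tS) /= -addSnnS leq_addr.
rewrite -mE; pose c : R := (#|S| <= m)%:R / (m ^_ #|seen t|)%:R.
(* Only fresh levels below [m] contribute: a repeated level has measure zero and a higher one
   dethrones [e0]. *)
rewrite /= (bigID (mem (fresh_below (seen (e :: t)) f m))) /= [X in _ + X]big1 ?addr0; last first.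
  move=> l; rewrite inE negb_and negbK inE => /orP[ls|lm].
    exact: isum_upd_dup.
  apply: (@isum_not_top _ _ _ e) => //; first by rewrite mem_seen eS.
  by rewrite !ffunE eqxx (negbTE e0e) -mE leqNgt.
rewrite (eq_bigr (fun=> c)) => [|l]; last first.
  rewrite inE [l \in [set _ | _]]inE => /andP[ls lm]; rewrite IH //.
  - by rewrite ffunE (negbTE e0e) -mE.
  - by rewrite (seen_cons eS et); apply: upd_inj.
  - rewrite (seen_cons eS et) top_upd // ffunE (negbTE e0e) -e0top -mE.
    by apply/esym/maxn_idPr.
rewrite sumr_const mE e0top card_fresh_below // -e0top -mE /c ks ffactnSr natrM.
have [dm|] := leqP; last by rewrite !mul0r mul0rn.
rewrite !mul1r -[LHS]mulr_natr invfM -mulrA mulVf ?mulr1 //.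
by rewrite pnatr_eq0 subn_eq0 -ltnNge (leq_trans kd).
Qed.

(** Sort the assignments by the edge on top, of which an injective assignment has at most one. By
    [isum_top] with only that edge revealed, each top level [m >= #|S|] contributes [1 / m]. *)
Lemma star_mass f :
  #|S|%:R * \sum_(l < J) (#|S| <= l.+1)%:R / l.+1%:R
  <= isum (enum S) star_measure f.
Proof.
have -> : #|S|%:R * \sum_(l < J) (#|S| <= l.+1)%:R / l.+1%:R
    = isum (enum S) (fun g => \sum_(e in S) star_measure g * is_top g e) f.
  rewrite isum_sum mulr_natl -sumr_const; apply: eq_bigr => e eS.
  have pe : perm_eq (enum S) (e :: rem e (enum S)) by rewrite perm_to_rem ?mem_enum.
  have ue : uniq (e :: rem e (enum S)) by rewrite -(perm_uniq pe) enum_uniq.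
  rewrite (isum_perm _ _ (enum_uniq _) pe).
  rewrite /=; apply: eq_bigr => l _; have /andP[et ut] := ue.
  have sE : seen (rem e (enum S)) = [set e].
    apply/setP => x; rewrite mem_seen inE rem_filter ?enum_uniq // mem_filter mem_enum /=.
    by have [->|] := eqVneq x e; rewrite ?eS // andbN.
  rewrite isum_top ?ffunE ?eqxx ?sE ?cards1 ?ffactn1 ?inE //.
  - by move=> x /mem_rem; rewrite mem_enum.
  - by move=> x y; rewrite !inE => /eqP -> /eqP ->.
  - by rewrite /top big_set1 ffunE eqxx.
apply: isum_le => [|g _]; first exact: enum_uniq.
rewrite -mulr_sumr -[leRHS]mulr1.
have [gI|ngI] := boolP (dinjectiveb g S); last by rewrite /star_measure (negbTE ngI) !mul0r.
apply: ler_wpM2l; first exact: star_measure_ge0.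
have [/existsP[e /andP[eS /eqP et]]|] := boolP [exists e in S, (g e).+1 == top S g].
  rewrite (bigD1 e) //= big1 ?addr0 => [|x /andP[xS xe]]; first by rewrite /is_top et eqxx.
  rewrite /is_top -et (_ : _ == _ = false) //; apply: contra_neqF xe => /eqP[/val_inj].
  by move/dinjectiveP: gI => gI /gI; apply.
rewrite negb_exists => /forallP none; rewrite big1 ?ler01 // => x xS.
by have := none x; rewrite xS /= /is_top => /negbTE ->.
Qed.

End Star.

(** * Telescoping and backward induction in one star *)

Section Harmonic.
Variable R : realType.

(** Telescoping: [1 / (l.+1 ^_ k.+1)] is [1 / k] times the difference of [1 / (l ^_ k)] and
    [1 / (l.+1 ^_ k)]. *)
Lemma sum_inv_ffact (m k n : nat) : (0 < k)%N -> (k <= m)%N -> (m <= n)%N ->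
  \sum_(m <= l < n) ((l.+1 ^_ k.+1)%:R^-1 : R)
  = k%:R^-1 * ((m ^_ k)%:R^-1 - (n ^_ k)%:R^-1).
Proof.
move=> k0 km; elim: n => [|n IH]; first by rewrite leqn0 => /eqP ->; rewrite big_geq // subrr mulr0.
rewrite leq_eqVlt => /orP[/eqP <-|mn]; first by rewrite big_geq // subrr mulr0.
rewrite ltnS in mn; rewrite big_nat_recr //= IH //.
case: k k0 km IH => // k _ km _.
set X := (m ^_ k.+1)%:R^-1.
rewrite !ffactSS (ffactnSr n k) !natrM natrB; last by lia.
have a0 : (n ^_ k)%:R != 0 :> R by rewrite pnatr_eq0 -lt0n ffact_gt0; lia.
have b0 : n%:R - k%:R != 0 :> R by rewrite -natrB ?pnatr_eq0; lia.
have c0 : n.+1%:R != 0 :> R by rewrite pnatr_eq0.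
have d0 : k.+1%:R != 0 :> R by rewrite pnatr_eq0.
move: a0 b0 c0 d0; rewrite -[n.+1]addn1 -[k.+1]addn1 !natrD => a0 b0 c0 d0.
by field; rewrite a0 b0 c0 d0.
Qed.

End Harmonic.

Section StarPotential.
Variables (R : realType) (G : graph) (J : nat) (v : vertex G) (wt : 'I_J -> R)
  (p : algorithm R G) (u : nat -> R).
Let S : {set edge G} := [set e | (ends e).1 == v].
Hypotheses (vp : valid_algorithm p) (u_ge0 : forall k, 0 <= u k)
  (u_rec : forall k, (0 < k < #|S|)%N -> u k.+1 + Num.max 1 (u k.+1) / k%:R <= u k).
Implicit Types (f g : {ffun edge G -> 'I_J}).

Definition top_gain o h g : R :=
  gain (first_reward v (is_top R S g)) p (fun e => wt (g e)) o h.

(** Let [k] edges be revealed, with top [m]. Each of the [m - k] fresh levels below [m] is worth at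
    most [u k.+1 / (m ^_ k.+1)], in total [u k.+1 / (m ^_ k)]. A new maximum [l.+1] is worth at most
    [Num.max 1 (u k.+1) / (l.+1 ^_ k.+1)], and these telescope to at most
    [Num.max 1 (u k.+1) / k / (m ^_ k)]. Hypothesis [u_rec] says that both together stay within
    [u k / (m ^_ k)]. *)
Lemma top_gain_potential o h f : uniq o -> ~~ taken v h ->
  let t := [seq e <- o | e \in S] in
  {in seen S t &, injective f} ->
  isum t (fun g => star_measure R S g * top_gain o h g) f
  <= if seen S t == set0 then \sum_(l < J) Num.max 1 (u 1%N) / l.+1%:R
     else u #|seen S t| / ((top (seen S t) f) ^_ #|seen S t|)%:R.
Proof.
have mx0 k : 0 <= Num.max 1 (u k) by rewrite le_max ler01.
have sum0 : 0 <= \sum_(l < J) Num.max 1 (u 1%N) / l.+1%:R.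
  by apply: sumr_ge0 => l _; rewrite divr_ge0 ?ler0n.
elim: o h f => [|e o IH] h f /=.
  move=> _ _ _; rewrite /top_gain /= mulr0; case: ifP => // _.
  by rewrite divr_ge0 ?ler0n.
move=> /andP[eo uo] nt.
set B := fun t => if seen S t == set0 then \sum_(l < J) Num.max 1 (u 1%N) / l.+1%:R
     else u #|seen S t| / ((top (seen S t) f) ^_ #|seen S t|)%:R.
have ut : uniq [seq x <- o | x \in S] by rewrite filter_uniq.
have et : e \notin [seq x <- o | x \in S] by rewrite mem_filter (negbTE eo) andbF.
case: ifP => [eS|/negbT eS] fI.
- set t := [seq x <- o | x \in S] in fI ut et |- *.
  have tS : {subset e :: t <= S}.
    by move=> x; rewrite inE mem_filter => /orP[/eqP ->|/andP[]].
  have ut1 : uniq (e :: t) by rewrite /= et.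
  have es : e \notin seen S (e :: t) by rewrite mem_seen mem_head andbF.
  have ev : (ends e).1 == v by move: eS; rewrite inE.
  set k := #|seen S (e :: t)|; set m := top (seen S (e :: t)) f.
  have kS : #|seen S t| = k.+1 by rewrite (seen_cons eS et) cardsU1 es.
  have snt : seen S t != set0 by rewrite -cards_eq0 kS.
  have kd : (k < #|S|)%N by rewrite -(card_seen ut1 tS) /= -addSnnS leq_addr.
  have km : (k <= m)%N by apply: card_le_top.
  (* Accepting ends the game in this star and rejecting continues it; a random decision is a mixture
     of the two, hence at most their maximum. *)
  have step l (A := isum t (fun g => star_measure R S g * is_top R S g e) (upd f e l))
      (Bl := isum t (fun g => star_measure R S g
                       * top_gain o (rcons h (e, wt l, false)) g) (upd f e l)) :
    isum t (fun g => star_measure R S g * top_gain (e :: o) h g) (upd f e l)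
     <= Num.max A Bl.
    have [/andP[p0 p1] _] := vp h e (wt l).
    rewrite (@eq_isum _ _ _ _ _ (fun g => p h e (wt l) * (star_measure R S g * is_top R S g e) +
      (1 - p h e (wt l)) * (star_measure R S g * top_gain o (rcons h (e, wt l, false)) g))) //.
      rewrite isumD !isumZ -/A -/Bl.
      have : A <= Num.max A Bl by rewrite le_max lexx.
      have : Bl <= Num.max A Bl by rewrite le_max lexx orbT.
      by nra.
    move=> g /(agree_upd et)[_ gel]; rewrite /top_gain /= gel gain_first_taken; last first.
      by rewrite taken_rcons ev.
    by rewrite {1}/first_reward ev nt /=; ring.
  have nt' l : ~~ taken v (rcons h (e, wt l, false)) by rewrite taken_rcons.
  have IHl l : l \notin f @: seen S (e :: t) ->
    isum t (fun g => star_measure R S g * top_gain o (rcons h (e, wt l, false)) g) (upd f e l)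
      <= u k.+1 / ((maxn l.+1 m) ^_ k.+1)%:R.
    move=> ls; have := IH (rcons h (e, wt l, false)) (upd f e l) uo (nt' l) => /=.
    rewrite -/t (negbTE snt) kS [seen S t](seen_cons eS et) top_upd // -/m; apply.
    exact: upd_inj.
  (* An edge below a revealed one can never be on top, so accepting it is worth 0. *)
  have low l : l \in fresh_below (seen S (e :: t)) f m ->
     isum t (fun g => star_measure R S g * top_gain (e :: o) h g) (upd f e l)
       <= u k.+1 / (m ^_ k.+1)%:R.
    rewrite inE [l \in [set _ | _]]inE => /andP[ls lm].
    apply: le_trans (step l) _; rewrite ge_max; apply/andP; split; last first.
      by have := IHl l ls; have /maxn_idPr -> : (l.+1 <= m)%N by [].
    have [s0|[x0 x0s]] := set_0Vmem (seen S (e :: t)).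
      by move: lm; rewrite /m s0 /top big_set0.
    have sgt0 : (0 < #|seen S (e :: t)|)%N by apply/card_gt0P; exists x0.
    have [x xs mx] := eq_bigmax_cond (fun x => (f x).+1) sgt0.
    have {}mx : m = (f x).+1 by [].
    rewrite (@isum_not_top _ _ _ _ _ _ _ x) ?divr_ge0 ?ler0n //.
      by rewrite (seen_cons eS et) in_setU1 xs orbT.
    have xe : x != e by apply/eqP => E0; move: es; rewrite -{1}E0 xs.
    rewrite !ffunE eqxx (negbTE xe).
    have lx : l != f x by apply: contraNneq ls => ->; apply: imset_f.
    by rewrite ltn_neqAle lx -ltnS -mx.
  have high (l : 'I_J) : (m <= l)%N ->
     isum t (fun g => star_measure R S g * top_gain (e :: o) h g) (upd f e l)
       <= Num.max 1 (u k.+1) / (l.+1 ^_ k.+1)%:R.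
    move=> ml; have ls : l \notin f @: seen S (e :: t).
      by apply/imsetP => -[x xs lx]; have := leq_top f xs; rewrite -/m -lx ltnNge ml.
    have mxl : maxn l.+1 m = l.+1 by apply/maxn_idPl/leqW.
    apply: le_trans (step l) _; rewrite ge_max; apply/andP; split; last first.
      apply: le_trans (IHl l ls) _; rewrite mxl ler_wpM2r ?invr_ge0 ?ler0n //.
      by rewrite le_max lexx orbT.
    rewrite isum_top ?ffunE ?eqxx ?kS //.
    + apply: ler_wpM2r; first by rewrite invr_ge0 ler0n.
      by rewrite le_max; case: (_ <= _)%N; rewrite ?lexx ?ler01.
    + by move=> x xt; apply: tS; rewrite inE xt orbT.
    + by rewrite mem_seen eS.
    + by rewrite (seen_cons eS et); apply: upd_inj.
    + by rewrite (seen_cons eS et) top_upd // -/m mxl.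
  pose b := u k.+1 / (m ^_ k.+1)%:R; pose hi l := Num.max 1 (u k.+1) / (l.+1 ^_ k.+1)%:R.
  have b0 : 0 <= b by rewrite divr_ge0 ?ler0n.
  have hi0 l : 0 <= hi l by rewrite divr_ge0 ?ler0n.
  have term l : isum t (fun g => star_measure R S g * top_gain (e :: o) h g) (upd f e l)
      <= (if l \in fresh_below (seen S (e :: t)) f m then b else 0)
         + (if (m <= l)%N then hi l else 0).
    case: ifP => [lf|/negbT lf].
      by apply: le_trans (low l lf) _; case: ifP => _; rewrite ?addr0 // lerDl.
    rewrite add0r; case: leqP => [ml|lm]; first exact: high.
    move: lf; rewrite inE [l \in [set _ | _]]inE lm andbT negbK => ls.
    by rewrite (isum_upd_dup _ _ eS ls).
  have {}term := ler_sum _ (fun l (_ : xpredT l) => term l).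
  rewrite /=; apply: le_trans (term _) _; rewrite big_split /= -!big_mkcond /=.
  rewrite sumr_const card_fresh_below // -/m -/k.
  have -> : \sum_(l < J | (m <= l)%N) hi l = \sum_(m <= l < J) hi l.
    by rewrite [RHS](big_nat_widenl m 0) // big_mkord.
  (* At the first arrival in the star [k = 0]: the sum over levels is harmonic and does not
     telescope, hence the separate case in the bound. *)
  case: ifP => [/eqP s0|/negbT sn0].
    have m0 : m = 0%N by rewrite /m s0 /top big_set0.
    have k0 : k = 0%N by rewrite /k s0 cards0.
    rewrite m0 big_mkord sub0n mulr0n add0r.
    by apply: ler_sum => l _; rewrite /hi k0 ffactn1.
  have k0 : (0 < k)%N by rewrite card_gt0.
  rewrite -mulr_sumr sum_inv_ffact ?top_le //.
  have fJ : 0 <= (J ^_ k)%:R^-1 :> R by rewrite invr_ge0 ler0n.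
  have fm : 0 < (m ^_ k)%:R^-1 :> R by rewrite invr_gt0 ltr0n ffact_gt0.
  have ki : 0 < k%:R^-1 :> R by rewrite invr_gt0 ltr0n.
  have bm : b *+ (m - k) <= u k.+1 / (m ^_ k)%:R.
    have [mk|mk] := leqP m k.
      by rewrite (eqP mk) mulr0n divr_ge0 ?ler0n.
    rewrite /b ffactnSr natrM -[leLHS]mulr_natr invfM -!mulrA mulVf ?mulr1 //.
    by rewrite pnatr_eq0 subn_eq0 -ltnNge.
  have ur := u_rec (k := k); rewrite k0 kd in ur; have {}ur := ur isT.
  have mxk := mx0 k.+1.
  set a1 := (m ^_ k)%:R^-1 in fm bm *; set a2 := (J ^_ k)%:R^-1 in fJ *.
  have h1 : 0 <= Num.max 1 (u k.+1) * k%:R^-1 * a2 by rewrite !mulr_ge0 // ltW.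
  have h2 := ler_wpM2r (ltW fm) ur.
  by move: h1 h2 bm; set M := Num.max _ _; set kk := k%:R^-1; lra.
- have [/andP[p0 p1] _] := vp h e (wt (f e)).
  have eF : e \notin S by [].
  have st b : ~~ taken v (rcons h (e, wt (f e), b)).
    by rewrite taken_rcons negb_or nt andbT negb_and; move: eF; rewrite inE => ->; rewrite orbT.
  have IHt := IH _ f uo (st true) fI; have IHf := IH _ f uo (st false) fI.
  rewrite (@eq_isum _ _ _ _ _ (fun g =>
      p h e (wt (f e)) * (star_measure R S g * top_gain o (rcons h (e, wt (f e), true)) g) +
      (1 - p h e (wt (f e))) *
        (star_measure R S g * top_gain o (rcons h (e, wt (f e), false)) g))) //.
    by rewrite isumD !isumZ; rewrite -/(B _) in IHt IHf *; nra.
  move=> g gf; rewrite /top_gain /= gf ?inE //.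
  rewrite {1}/first_reward; move: eF; rewrite inE => /negbTE -> /=; ring.
Qed.

End StarPotential.

(** * The secretary recursion *)

Section Numbers.
Variable R : realType.

Lemma expR_harmonic_ge n : n.+1%:R <= expR (\sum_(l < n) l.+1%:R^-1 : R).
Proof.
elim: n => [|n IH]; first by rewrite big_ord0 expR0.
rewrite big_ord_recr /= expRD.
apply: le_trans (ler_pM _ _ IH (expR_ge1Dx n.+1%:R^-1)) => //.
- by rewrite mulrDr mulr1 mulfV ?pnatr_eq0 // -natr1.
- by rewrite addr_ge0 // invr_ge0.
Qed.

(** From [expR (- 1 / n) >= 1 - 1 / n] come factors that telescope; the form without division covers
    [K = 1]. *)
Lemma expR_inv_harmonic_le K n : (0 < K <= n)%N ->
  (K%:R - 1) * expR (\sum_(K <= j < n) j%:R^-1) <= n%:R - 1 :> R.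
Proof.
move=> /andP[K0]; elim: n => [|n IH]; first by rewrite leqn0; case: K K0.
rewrite leq_eqVlt => /orP[/eqP <-|]; first by rewrite big_geq // expR0 mulr1.
rewrite ltnS => Kn; rewrite big_nat_recr //= expRD mulrA.
have n0 : 0 < n%:R :> R by rewrite ltr0n; exact: leq_trans Kn.
have step : (n%:R - 1) * expR n%:R^-1 <= n%:R :> R.
  have := expR_ge1Dx (- n%:R^-1 : R); rewrite expRN => h.
  have := ler_wpM2r (ltW (mulr_gt0 n0 (expR_gt0 (n%:R^-1 : R)))) h.
  rewrite [leRHS]mulrCA mulVf ?mulr1 ?gt_eqF ?expR_gt0 //.
  suff -> : (1 - n%:R^-1) * (n%:R * expR n%:R^-1) = (n%:R - 1) * expR n%:R^-1 :> R by [].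
  by rewrite mulrA mulrBl mul1r mulVf ?gt_eqF.
rewrite -natr1 addrK; apply: le_trans step; apply: ler_wpM2r; first exact: expR_ge0.
exact: IH.
Qed.

(* The secretary recursion has the solution [S k] above the threshold [K], where
   [S k] is the tail of the harmonic sum up to [d], and [K * S K / k] below it. *)
Lemma secretary_recursion (d : nat) : (1 < d)%N ->
  exists u : nat -> R, [/\ forall k, 0 <= u k,
    forall k, (0 < k < d)%N -> u k.+1 + Num.max 1 (u k.+1) / k%:R <= u k &
    Num.max 1 (u 1%N) <= d%:R / expR 1 + 2].
Proof.
move=> d1; pose S k : R := \sum_(k <= j < d) j%:R^-1.
have Sge0 k : 0 <= S k by apply: sumr_ge0 => j _; rewrite invr_ge0.
have SS k : (k < d)%N -> S k = k%:R^-1 + S k.+1 by move=> kd; rewrite /S big_ltn.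
(* The largest [K] with [1 <= S K] is the classical stopping threshold: beyond it, taking a current
   maximum is at least as good as waiting. *)
pose P k := (0 < k)%N && (1 <= S k).
have exP : exists k, P k by exists 1%N; rewrite /P (SS 1%N) //= invr1 lerDl Sge0.
have Pd k : P k -> (k <= d)%N.
  move=> /andP[_]; apply: contraTT; rewrite -ltnNge => dk.
  by rewrite /S big_geq ?ler10 // ltnW.
case: (ex_maxnP exP Pd) => K /andP[K0 SK1] Kmax.
have Kd : (K < d)%N.
  rewrite ltnNge; apply/negP => dK; move: SK1.
  by rewrite /S big_geq // ler10.
have SK1' k : (K < k)%N -> S k <= 1.
  move=> Kk; rewrite leNgt; apply/negP => /ltW Sk.
  by have := Kmax k; rewrite /P Sk (leq_ltn_trans _ Kk) // leqNgt Kk; move/(_ isT).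
have K0R : 0 < K%:R :> R by rewrite ltr0n.
pose u k := if (K <= k)%N then S k else K%:R * S K / k%:R.
have u1E : u 1%N = K%:R * S K.
  rewrite /u; case: leqP => [K1|_]; last by rewrite divr1.
  have -> : K = 1%N by apply/eqP; rewrite eqn_leq K1 K0.
  by rewrite mul1r.
have K1 : 1 <= K%:R :> R by rewrite ler1n.
exists u; split.
- by move=> k; rewrite /u; case: ifP => // _; rewrite !mulr_ge0 ?invr_ge0.
- move=> k /andP[k0 kd]; have [Kk|kK] := leqP K k.
    have uS : u k.+1 = S k.+1 by rewrite /u leqW.
    have -> : u k = S k by rewrite /u Kk.
    by rewrite uS max_l ?SK1' // (SS k kd) mul1r addrC.
  have k0R : k%:R != 0 :> R by rewrite pnatr_eq0 -lt0n.
  have uS : u k.+1 = K%:R * S K / k.+1%:R.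
    rewrite /u; case: leqP => // Kk; have -> : k.+1 = K by apply/eqP; rewrite eqn_leq Kk kK.
    by rewrite mulrAC mulfV ?mul1r // gt_eqF.
  have u1 : 1 <= u k.+1.
    rewrite uS ler_pdivlMr ?ltr0n // mul1r; apply: le_trans (_ : K%:R * 1 <= _).
      by rewrite mulr1 ler_nat.
    by rewrite ler_wpM2l.
  have -> : u k = K%:R * S K / k%:R by rewrite /u leqNgt kK.
  rewrite max_r // uS -[k.+1]addn1 natrD.
  have k1R : k%:R + 1 != 0 :> R by rewrite natr1 pnatr_eq0.
  rewrite le_eqVlt; apply/orP; left; apply/eqP; field; by rewrite k0R k1R.
- rewrite u1E max_r; last by nra.
  (* Since [K * S K = 1 + K * S K.+1], maximality of [K] suffices. Together with [K - 1 <= d / e]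
     this produces the constant 2. *)
  have KS : K%:R * S K <= K%:R + 1.
    rewrite SS // mulrDr mulfV ?gt_eqF // addrC lerD2r -[leRHS]mulr1 ler_wpM2l //.
    exact: SK1'.
  apply: le_trans KS _.
  have e0 := expR_gt0 (1 : R).
  have h := @expR_inv_harmonic_le K d; rewrite K0 ltnW // in h; have {}h := h isT.
  have h1 : expR 1 <= expR (S K) by rewrite ler_expR.
  have h2 : (K%:R - 1) * expR 1 <= d%:R - 1 :> R.
    by apply: (le_trans _ h); rewrite ler_wpM2l // subr_ge0.
  have h3 : K%:R - 1 <= (d%:R - 1) / expR 1 :> R by rewrite ler_pdivlMr.
  have h4 : (d%:R - 1) / expR 1 <= d%:R / expR 1 :> R.
    by rewrite ler_pM2r ?invr_gt0 // lerBlDr lerDl.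
  by lra.
Qed.

Lemma secretary_parameters (eps : R) : 0 < eps ->
  exists d J : nat, exists u : nat -> R,
    [/\ (0 < d)%N, forall k, 0 <= u k,
        forall k, (0 < k < d)%N -> u k.+1 + Num.max 1 (u k.+1) / k%:R <= u k,
        0 < \sum_(l < J) (d <= l.+1)%:R / l.+1%:R :> R &
        \sum_(l < J) Num.max 1 (u 1%N) / l.+1%:R
          <= ((expR 1)^-1 + eps) * (d%:R * \sum_(l < J) (d <= l.+1)%:R / l.+1%:R)].
Proof.
(* [eps * d > 4] pays for the additive 2 in [secretary_recursion] and leaves another 2 per unit of
   the harmonic sum. *)
move=> eps0; pose d := (Num.bound (4 / eps)).+2.
have d4 : 4 < eps * d%:R.
  have := archi_boundP (ltW (divr_gt0 (ltr0Sn R 3) eps0)).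
  rewrite ltr_pdivrMr // => h.
  have : (Num.bound (4 / eps))%:R <= d%:R :> R by rewrite ler_nat /d; lia.
  by nra.
have [u [u0 ur u1]] := @secretary_recursion d isT.
have e0 : 0 < (expR 1)^-1 :> R by rewrite invr_gt0 expR_gt0.
pose c : R := (expR 1)^-1 + eps.
have c0 : 0 < c by rewrite addr_gt0.
have d0 : 0 < d%:R :> R by rewrite ltr0n.
(* Cutting the harmonic sum [H] at [d] loses at most [d], that is [c * d * d] after scaling, which
   the spare [2 * H] covers once [H >= B]. The summand [d + 1] makes the tail positive and gives
   [d <= J]. *)
pose B : R := c * d%:R * d%:R + d%:R + 1.
have B0 : 0 <= B by rewrite /B; nra.
pose J := Num.bound (expR B).
pose H : R := \sum_(l < J) l.+1%:R^-1.
have HB : B <= H.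
  rewrite -ler_expR; apply: le_trans (expR_harmonic_ge J).
  by apply: le_trans (ltW (archi_boundP (expR_ge0 _))) _; rewrite ler_nat.
have dJ : (d <= J)%N.
  rewrite -(ler_nat R); apply: le_trans (ltW (archi_boundP (expR_ge0 _))).
  by apply: le_trans (expR_ge1Dx B); rewrite /B; nra.
pose T : R := \sum_(l < J) (d <= l.+1)%:R / l.+1%:R.
have TH : H - d%:R <= T.
  rewrite lerBlDr -{1}(card_lt_ord dJ) -sum1_card natr_sum big_mkcond /= -big_split /=.
  apply: ler_sum => l _; rewrite inE; have [|ld] := leqP d l.+1.
    by rewrite mul1r lerDl; case: ifP.
  by rewrite mul0r add0r ltnW //= invf_le1 ?ltr0n // ler1n.
exists d, J, u; split=> //; first by rewrite -/T /B in HB TH *; nra.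
rewrite -mulr_sumr -/H -/T -/c.
have H0 : 0 <= H by lra.
have cd : d%:R / expR 1 + 2 <= c * d%:R - 2 :> R.
  by rewrite /c; nra.
have h1 : Num.max 1 (u 1%N) * H <= (c * d%:R - 2) * H by rewrite ler_wpM2r // (le_trans u1).
have h2 : c * d%:R * (H - d%:R) <= c * d%:R * T by rewrite ler_wpM2l // mulr_ge0 // ltW.
rewrite mulrA; move: h1 h2 HB; rewrite /B; nra.
Qed.

End Numbers.

(** * The hard instance *)

Section Instance.
Variables (R : realType) (G : graph) (A : {set vertex G}) (d C g J M : nat)
  (u : nat -> R) (eps c : R).
Hypotheses (starG : star_graph A d C g) (d_gt0 : (0 < d)%N) (M_gt0 : (0 < M)%N)
  (u_ge0 : forall k, 0 <= u k)
  (u_rec : forall k, (0 < k < d)%N -> u k.+1 + Num.max 1 (u k.+1) / k%:R <= u k)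
  (mass_gt0 : 0 < \sum_(l < J) (d <= l.+1)%:R / l.+1%:R :> R)
  (c_ge0 : 0 <= c)
  (c_bound : \sum_(l < J) Num.max 1 (u 1%N) / l.+1%:R
     <= c * (d%:R * \sum_(l < J) (d <= l.+1)%:R / l.+1%:R)).
Implicit Types (f : {ffun edge G -> 'I_J}) (p : algorithm R G).

Definition star v : {set edge G} := [set e | (ends e).1 == v].

Definition weight_of (l : 'I_J) : R := M%:R ^+ l.

Definition star_max v f : R := M%:R ^+ (top (star v) f).-1.

(* Dividing by [star_max] makes every scale of the star contribute equally to
   the expected optimum. *)
Definition level_measure f : R :=
  \prod_(v in A) (star_measure R (star v) f / star_max v f).

Let M_ge1 : 1 <= M%:R :> R. Proof. by rewrite ler1n. Qed.

Let M_pos : 0 < M%:R :> R. Proof. by rewrite ltr0n. Qed.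

Lemma star_max_gt0 v f : 0 < star_max v f.
Proof. exact: exprn_gt0. Qed.

Lemma level_measure_ge0 f : 0 <= level_measure f.
Proof.
by apply: prodr_ge0 => v _; rewrite divr_ge0 ?star_measure_ge0 ?ltW ?star_max_gt0.
Qed.

Lemma mem_star v e : (e \in star v) = ((ends e).1 == v).
Proof. by rewrite inE. Qed.

Lemma card_star v : v \in A -> #|star v| = d.
Proof. exact: (star_degree starG). Qed.

(** Missing the top level costs at least a factor [M], so up to [1 / M] only the maximal edge of a
    star is worth anything. *)
Lemma weight_le_top f e v : e \in star v ->
  weight_of (f e) <= star_max v f * (is_top R (star v) f e + M%:R^-1).
Proof.
move=> ev; have lt := leq_top f ev; rewrite /weight_of /star_max /is_top.
set t := top _ _ in lt *.
have [et|ne] := eqVneq (f e).+1 t.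
  rewrite -et /= mulrDr mulr1 lerDl mulr_ge0 ?exprn_ge0 ?invr_ge0 ?ltW //.
have lt2 : ((f e).+1 < t)%N by rewrite ltn_neqAle ne.
case: t lt2 {lt ne} => // t lt2; rewrite add0r ler_pdivlMr // -exprSr /=.
by rewrite ler_weXn2l.
Qed.

Lemma gain_first_le v p o f : valid_algorithm p ->
  gain (first_reward v (fun e => weight_of (f e))) p (fun e => weight_of (f e)) o [::]
  <= star_max v f * (top_gain v weight_of p o [::] f + M%:R^-1).
Proof.
move=> vp; have m0 := ltW (star_max_gt0 v f).
apply: le_trans (_ : gain (fun h e => star_max v f * (first_reward v (is_top R (star v) f) h e
   + M%:R^-1 * first_reward v (fun=> 1) h e)) p (fun e => weight_of (f e)) o [::] <= _).
  apply: gain_le => // h e; rewrite /first_reward; case: ifP => [/andP[ev _]|_].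
    by rewrite mulr1; apply: weight_le_top; rewrite mem_star.
  by rewrite mulr0 addr0 mulr0.
rewrite gainZ gainD gainZ; apply: ler_wpM2l => //; rewrite lerD2l.
rewrite -[leRHS]mulr1; apply: ler_wpM2l; first by rewrite invr_ge0 ltW.
exact: gain_first_le1.
Qed.

(** All levels outside the star are fixed before those inside it are summed, and the bound holds for
    each choice; the algorithm may thus use whatever it learns from the other stars. *)
Lemma star_bound v p o : v \in A -> valid_algorithm p -> uniq o -> (forall e, e \in o) ->
  \sum_f level_measure f *
     gain (first_reward v (fun e => weight_of (f e))) p (fun e => weight_of (f e)) o [::]
  <= (c + M%:R^-1) * \sum_f level_measure f * star_max v f.
Proof.
move=> vA vp uo oall.
have J_gt0 : (0 < J)%N.
  by case: J mass_gt0 => //; rewrite big_ord0 ltxx.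
pose f0 : {ffun edge G -> 'I_J} := [ffun=> Ordinal J_gt0].
pose t := [seq e <- o | e \in star v]; pose r := [seq e <- o | e \notin star v].
have ut : uniq t by rewrite filter_uniq.
have prt : perm_eq (r ++ t) o by rewrite perm_catC perm_filterC.
have urt : uniq (r ++ t) by rewrite (perm_uniq prt).
have allrt x : x \in r ++ t by rewrite (perm_mem prt).
rewrite -!(isum_all _ f0 urt allrt) !isum_cat -isumZ.
apply: isum_le => [|f _]; first by rewrite filter_uniq.
(* The other stars contribute a factor that stays constant while the levels in [t] vary. *)
pose K f := \prod_(v' in A | v' != v) (star_measure R (star v') f / star_max v' f).
have muE f' : level_measure f' = K f' * (star_measure R (star v) f' / star_max v f').
  by rewrite /level_measure (bigD1 v) //= mulrC.
have KE f' : {in predC (mem t), f' =1 f} -> K f' = K f.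
  move=> ff; apply: eq_bigr => v' /andP[_ v'v].
  have eqv : {in star v', f' =1 f}.
    move=> x; rewrite mem_star => /eqP xv'; apply: ff.
    by rewrite !inE mem_filter mem_star xv' (negbTE v'v).
  rewrite /star_max (eq_top eqv) /star_measure (eq_top eqv).
  suff -> : dinjectiveb f' (star v') = dinjectiveb f (star v') by [].
  by apply/dinjectiveP/dinjectiveP => fI x y xv yv; move: (fI x y xv yv); rewrite !eqv.
have K_ge0 f' : 0 <= K f'.
  by apply: prodr_ge0 => v' _; rewrite divr_ge0 ?star_measure_ge0 ?ltW ?star_max_gt0.
have mE f' : K f' * (star_measure R (star v) f' / star_max v f') * star_max v f'
     = K f' * star_measure R (star v) f'.
  by rewrite -!mulrA mulVf ?mulr1 // gt_eqF // star_max_gt0.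
have -> : isum t (fun f' => level_measure f' * star_max v f') f
    = K f * isum t (star_measure R (star v)) f.
  by rewrite -isumZ; apply: eq_isum => // f' ff; rewrite muE mE KE.
apply: le_trans (_ : K f *
  (isum t (fun f' => star_measure R (star v) f' * top_gain v weight_of p o [::] f') f
   + M%:R^-1 * isum t (star_measure R (star v)) f) <= _).
  rewrite -isumZ -isumD -isumZ; apply: isum_le => // f' ff.
  rewrite muE -(KE f' ff).
  apply: le_trans (ler_wpM2l _ (gain_first_le v o f' vp)) _.
    by rewrite mulr_ge0 // divr_ge0 ?star_measure_ge0 ?ltW ?star_max_gt0.
  rewrite [leLHS]mulrA mE le_eqVlt; apply/orP; left; apply/eqP; ring.
rewrite mulrCA; apply: ler_wpM2l => //; rewrite mulrDl lerD2r.
have et : perm_eq t (enum (star v)).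
  apply: uniq_perm => //; first exact: enum_uniq.
  by move=> x; rewrite mem_filter mem_enum oall andbT.
have s0 : seen (star v) t = set0.
  by apply/setP => x; rewrite mem_seen mem_filter oall andbT andbN inE.
have nt : ~~ taken v ([::] : history R G).
  by rewrite negb_exists; apply/forallP => x; rewrite inE.
have := @top_gain_potential R G J v weight_of p u vp u_ge0 _ o [::] f uo nt.
rewrite -/(star v) (card_star vA) /= -/t s0 eqxx => H.
apply: le_trans (H u_rec _) _; first by move=> x y; rewrite inE.
apply: le_trans c_bound _; apply: ler_wpM2l => //.
rewrite (isum_perm _ _ ut et) -(card_star vA).
exact: star_mass.
Qed.

Lemma OPT_ge_star f : \sum_(v in A) star_max v f <= OPT (fun e => weight_of (f e)).
Proof.
pose best v := [pick e in star v | (f e).+1 == top (star v) f].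
pose F : {set edge G} := [set e | best (ends e).1 == Some e].
have acF : acyclic F.
  apply: (star_choice_acyclic (star_ends1 starG) (star_ends2 starG)) => x y.
  by rewrite !inE => /eqP bx /eqP besty E; rewrite E besty in bx; case: bx.
have wpos e : 0 <= weight_of (f e) by rewrite exprn_ge0 // ltW.
apply: le_trans (_ : \sum_(e in F) weight_of (f e) <= _); last first.
  apply: (@le_bigmax_cond _ _ _ _ F _
    (fun F : {set edge G} => \sum_(e in F) weight_of (f e))).
  exact/asboolP.
rewrite (partition_big (fun e => (ends e).1) (mem A)) /=; last first.
  by move=> e _; apply: (star_ends1 starG).
apply: ler_sum => v vA.
have sgt0 : (0 < #|star v|)%N by rewrite card_star.
have [e ev te] := eq_bigmax_cond (fun x => (f x).+1) sgt0.
have [e' /andP[e'v /eqP te'] be'] : exists2 e',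
    (e' \in star v) && ((f e').+1 == top (star v) f) & best v = Some e'.
  rewrite /best; case: pickP => [e' He'|/(_ e)]; first by exists e'.
  by rewrite /= ev /top te eqxx.
have ve' : (ends e').1 = v by apply/eqP; rewrite -mem_star.
rewrite (bigD1 e') /=; last by rewrite inE ve' be' !eqxx.
rewrite /star_max -te' /= lerDl; exact: sumr_ge0.
Qed.

Lemma OPT_ge_card f : #|A|%:R <= OPT (fun e => weight_of (f e)).
Proof.
apply: le_trans (OPT_ge_star f); rewrite -sum1_card natr_sum.
by apply: ler_sum => v _; rewrite exprn_ege1.
Qed.

Lemma level_measure_pos : exists f, 0 < level_measure f.
Proof.
have dJ : (d <= J)%N.
  rewrite leqNgt; apply/negP => Jd; move: mass_gt0; rewrite big1 ?ltxx // => l _.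
  by rewrite leqNgt (leq_ltn_trans (ltn_ord l) Jd) mul0r.
(* Numbering the edges within each star gives distinct levels below [d <= J]. *)
have idx e : (index e (enum (star (ends e).1)) < J)%N.
  apply: leq_trans dJ; rewrite -(card_star (star_ends1 starG e)) cardE index_mem mem_enum.
  by rewrite mem_star.
exists [ffun e => Ordinal (idx e)]; apply: prodr_gt0 => v vA.
rewrite divr_gt0 ?star_max_gt0 //.
set f := finfun _.
have fI : {in star v &, injective f}.
  move=> x y xv yv; rewrite !ffunE => /(congr1 val) /= E.
  move: (xv) (yv) E; rewrite !mem_star => /eqP -> /eqP -> E.
  by have := congr1 (nth x (enum (star v))) E; rewrite !nth_index ?mem_enum.
rewrite /star_measure (_ : dinjectiveb f (star v)); last exact/dinjectiveP.
by rewrite invr_gt0 ltr0n ffact_gt0 card_le_top.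
Qed.

Lemma run_bound p o : valid_algorithm p -> uniq o -> (forall e, e \in o) ->
  M%:R ^+ J <= eps * C%:R ->
  \sum_f level_measure f * run p (fun e => weight_of (f e)) o [::]
  <= (c + M%:R^-1 + eps) * \sum_f level_measure f * OPT (fun e => weight_of (f e)).
Proof.
move=> vp uo oall WC; rewrite [leRHS]mulrDl.
have acc0 : accepted ([::] : history R G) = set0 by apply/setP => x; rewrite !inE.
have extra f : gain (extra_reward (fun e => weight_of (f e))) p (fun e => weight_of (f e)) o [::]
    <= eps * OPT (fun e => weight_of (f e)).
  have W0 : 0 <= M%:R ^+ J :> R by rewrite exprn_ge0 // ltW.
  have := @gain_extra_le R G A (M%:R ^+ J) p (fun e => weight_of (f e)) o [::]
    (star_ends1 starG) (star_ends2 starG) vp W0.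
  rewrite acc0 imset0 !cards0 mulr0n addr0 subr0 => H.
  apply: le_trans (H _ uo _ _) _.
  - by move=> e; rewrite ler_weXn2l // ltnW.
  - by move=> e _; rewrite inE.
  - by move=> k [k0 [es [vs [_ _ /(_ (Ordinal k0))]]]]; rewrite inE.
  (* The budget of [#|~: A|] surplus edges of weight at most [M ^ J] is set against [C * #|~: A|]
     stars, each with maximum weight at least 1. *)
  apply: le_trans (_ : eps * #|A|%:R <= _).
    rewrite (star_many starG) natrM mulrA; exact: ler_wpM2r.
  have eps0 : 0 <= eps.
    rewrite leNgt; apply/negP => e0; move: WC; rewrite leNgt => /negP; apply.
    have W1 : 0 < M%:R ^+ J :> R by rewrite exprn_gt0.
    have C0 : 0 <= C%:R :> R by [].
    by nra.
  by apply: ler_wpM2l => //; apply: OPT_ge_card.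
rewrite (eq_bigr (fun f => \sum_(v in A) level_measure f *
     gain (first_reward v (fun e => weight_of (f e))) p (fun e => weight_of (f e)) o [::]
   + level_measure f *
     gain (extra_reward (fun e => weight_of (f e))) p (fun e => weight_of (f e)) o [::]));
  last first.
  move=> f _; rewrite run_split mulrDr; congr (_ + _); rewrite mulr_sumr.
  rewrite (bigID (mem A)) /= [X in _ + X]big1 ?addr0 // => v vA.
  rewrite gain_first_notin ?mulr0 // => e _.
  by apply: contraNneq vA => <-; apply: (star_ends1 starG).
rewrite big_split /=; apply: lerD.
  rewrite exchange_big /=; apply: le_trans (ler_sum _ (fun v vA => star_bound vA vp uo oall)) _.
  rewrite -mulr_sumr; apply: ler_wpM2l; first by rewrite addr_ge0 // invr_ge0.
  rewrite exchange_big /=; apply: ler_sum => f _; rewrite -mulr_sumr.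
  by apply: ler_wpM2l; [exact: level_measure_ge0|exact: OPT_ge_star].
rewrite mulr_sumr; apply: ler_sum => f _; rewrite mulrCA.
by apply: ler_wpM2l; [exact: level_measure_ge0|exact: extra].
Qed.

(** [run_bound] holds for every fixed arrival order, so it survives averaging. *)
Lemma expected_bound p : valid_algorithm p -> M%:R ^+ J <= eps * C%:R ->
  \sum_f level_measure f * expected_alg p (fun e => weight_of (f e))
  <= (c + M%:R^-1 + eps) * \sum_f level_measure f * OPT (fun e => weight_of (f e)).
Proof.
move=> vp WC; set B := leRHS.
have cp : #|{perm edge G}| = (#|edge G|)`!.
  rewrite -[#|edge G|]cardsT -card_perm; apply: eq_card => s.
  by rewrite [RHS](_ : _ = true) //; apply/subsetP => x _; rewrite inE.
have fn0 : (#|edge G|)`!%:R != 0 :> R by rewrite pnatr_eq0 -lt0n fact_gt0.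
rewrite (eq_bigr (fun f => (#|edge G|)`!%:R^-1 *
    \sum_(s : {perm edge G}) level_measure f *
      run p (fun e => weight_of (f e)) [seq s x | x <- enum (edge G)] [::])); last first.
  by move=> f _; rewrite /expected_alg mulrCA mulr_sumr.
rewrite -mulr_sumr exchange_big /= ler_pdivrMl ?lt0r ?fn0 ?ler0n //.
rewrite -cp mulr_natl -sumr_const; apply: ler_sum => s _.
apply: run_bound => //.
  by rewrite map_inj_uniq ?enum_uniq //; exact: perm_inj.
by move=> e; rewrite -(permKV s e) map_f // mem_enum.
Qed.

End Instance.

(** * From the instance to the competitive ratio *)

Lemma OPT_gt0 (R : realType) (G : graph) (w : edge G -> R) :
  simple_graph G -> (0 < #|edge G|)%N -> positive_weights w -> 0 < OPT w.
Proof.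
move=> [noloop _] /card_gt0P[e _] wpos; apply: lt_le_trans (wpos e) _.
have -> : w e = \sum_(x in [set e]) w x by rewrite big_set1.
apply: (@le_bigmax_cond _ _ _ _ [set e] _ (fun F : {set edge G} => \sum_(e in F) w e)).
apply/asboolP => k [k0 [es [vs [esI _ esF esJ]]]].
have ese i : es i = e by apply/set1P.
have /esI E : es (Ordinal k0) = es (ordS (Ordinal k0)) by rewrite !ese.
have J1 := esJ (Ordinal k0); rewrite -E ese in J1.
by case/joins_endsP: J1 => L; have := noloop e; rewrite L eqxx.
Qed.

Lemma expected_alg_ge0 (R : realType) (G : graph) (p : algorithm R G) (w : edge G -> R) :
  valid_algorithm p -> positive_weights w -> 0 <= expected_alg p w.
Proof.
move=> vp wpos; rewrite mulr_ge0 ?invr_ge0 // sumr_ge0 // => s _.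
rewrite run_gain -(gain0 p w [seq s x | x <- enum (edge G)] [::]).
by apply: gain_le => // _ e; apply: ltW.
Qed.

Lemma hard_distribution (R : realType) (eps : R) (g : nat) : 0 < eps ->
    exists (G : graph) (D : seq (R * (edge G -> R))),
      [/\ simple_graph G, girth_ge G g, (0 < #|edge G|)%N,
          weight_distribution D &
          forall p : algorithm R G, valid_algorithm p ->
            \sum_(qw <- D) qw.1 * (expected_alg p qw.2 / OPT qw.2)
              < (expR (1 : R))^-1 + eps].
Proof.
(* One quarter each for the finite star problem, for [1 / M] and for the surplus edges; the fourth
   makes the inequality strict. *)
move=> eps0; have e4 : 0 < eps / 4 by rewrite divr_gt0.
have [d [J [u [d0 u0 ur mass0 cb]]]] := secretary_parameters e4.
pose M := (Num.bound (eps / 4)^-1).+1.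
have Me : M%:R^-1 <= eps / 4.
  rewrite -[leRHS]invrK lef_pV2 ?posrE ?invr_gt0 //.
  by apply: le_trans (ltW (archi_boundP _)) _; rewrite ?ler_nat // invr_ge0 ltW.
pose C := (Num.bound (M%:R ^+ J / (eps / 4))).+1.
have CW : M%:R ^+ J <= eps / 4 * C%:R.
  rewrite mulrC -ler_pdivrMr //.
  by apply: le_trans (ltW (archi_boundP _)) _; rewrite ?ler_nat // divr_ge0 ?exprn_ge0 // ltW.
have [G [A sG]] := star_graph_exists C g d0.
have c0 : 0 <= (expR 1)^-1 + eps / 4 by rewrite addr_ge0 ?invr_ge0 ?expR_ge0 // ltW.
have A0 : (0 < #|A|)%N by rewrite (star_many sG) muln_gt0 (star_nonempty sG).
pose w (f : {ffun edge G -> 'I_J}) (e : edge G) : R := weight_of R M (f e).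
pose mu (f : {ffun edge G -> 'I_J}) : R := level_measure R A M f.
pose Z := \sum_f mu f * OPT (w f).
have OPT0 f : 0 < OPT (w f).
  by apply: lt_le_trans (OPT_ge_card R sG d0 (isT : (0 < M)%N) f); rewrite ltr0n.
have mu0 f : 0 <= mu f by apply: level_measure_ge0.
have Z0 : 0 < Z.
  have [f f0] := level_measure_pos sG (isT : (0 < M)%N) mass0.
  rewrite /Z (bigD1 f) //= ltr_wpDr ?mulr_gt0 // sumr_ge0 // => f' _.
  by rewrite mulr_ge0 // ltW.
exists G, [seq (mu f * OPT (w f) / Z, w f) | f <- enum {: {ffun edge G -> 'I_J}}]; split.
- exact: star_simple sG.
- exact: star_girth sG.
- have /card_gt0P[v vA] := A0.
  have : (0 < #|[set e : edge G | (ends e).1 == v]|)%N by rewrite (star_degree sG).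
  by move=> /card_gt0P[e _]; apply/card_gt0P; exists e.
- split.
    move=> _ /mapP[f _ ->] /=; split; last by move=> e; rewrite exprn_gt0.
    by rewrite !mulr_ge0 ?invr_ge0 // ltW.
  by rewrite big_map big_enum /= -mulr_suml mulfV // gt_eqF.
move=> p vp; rewrite big_map big_enum /=.
rewrite (eq_bigr (fun f => mu f * expected_alg p (w f) / Z)); last first.
  move=> f _; have := OPT0 f => /gt_eqF /negbT o0.
  by rewrite mulrAC mulrACA [OPT _ / _]mulfV // mulr1 mulrAC.
rewrite -mulr_suml ltr_pdivrMr //.
apply: le_lt_trans (expected_bound sG d0 (isT : (0 < M)%N) u0 ur mass0 c0 cb vp CW) _.
by rewrite ltr_pM2r //; lra.
Qed.

Theorem theorem3 (R : realType) :
  (forall (eps : R) (g : nat), 0 < eps ->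
    exists (G : graph) (D : seq (R * (edge G -> R))),
      [/\ simple_graph G, girth_ge G g, (0 < #|edge G|)%N,
          weight_distribution D &
          forall p : algorithm R G, valid_algorithm p ->
            \sum_(qw <- D) qw.1 * (expected_alg p qw.2 / OPT qw.2)
              < (expR (1 : R))^-1 + eps])
  /\
  (forall (g : nat) (alpha : R), alpha < expR 1 ->
    ~ exists A : alg_family R,
        (forall G, valid_algorithm (A G)) /\
        competitive_on alpha (fun G => simple_graph G /\ girth_ge G g) A).
Proof.
split=> [eps g|g alpha alpha_e [a [va comp]]]; first exact: hard_distribution.
have e0 := expR_gt0 (1 : R).
have [alpha0|alpha0] := leP alpha 0.
  have [G [_ [sG gG E0 _ _]]] := hard_distribution g (ltr01 : 0 < 1 :> R).
  have w0 : positive_weights (fun _ : edge G => 1 : R) by move=> e; apply: ltr01.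
  have := comp G (conj sG gG) _ w0; rewrite leNgt => /negP; apply.
  apply: le_lt_trans (OPT_gt0 sG E0 w0).
  by rewrite mulr_le0_ge0 // expected_alg_ge0.
(* With this [eps] the hard bound equals [alpha^-1], while a competitive algorithm reaches at least
   the ratio [alpha^-1] on every weight function of the support. *)
have eps0 : 0 < alpha^-1 - (expR 1)^-1 by rewrite subr_gt0 ltf_pV2 ?posrE.
have [G [D [sG gG E0 [D0 D1] hard]]] := hard_distribution g eps0.
have := hard (a G) (va G); rewrite addrC subrK ltNge => /negP; apply.
rewrite -[leLHS]mul1r -D1 mulr_suml big_seq [leRHS]big_seq.
apply: ler_sum => qw /D0[q0 w0]; apply: ler_wpM2l => //.
rewrite ler_pdivlMr ?OPT_gt0 // mulrC ler_pdivrMr // mulrC.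
exact: comp.
Qed.
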